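(* For every integer $r\geq 4$ and every $K_{r-1}$-free graph $F$, there exists $\varepsilon=\varepsilon_F>0$ such that $f_{F,K_r}(n)=O(n^{1/2-\varepsilon})$ as $n\to\infty$.
   Context: All graphs are finite and simple. A graph is $F$-free if it does not contain $F$ as a (not necessarily induced) subgraph. For graphs $F,H$ and a positive integer $n$, $f_{F,H}(n)$ denotes the largest $m$ such that every $H$-free graph on $n$ vertices contains an $F$-free induced subgraph on $m$ vertices. $K_r$ is the complete graph on $r$ vertices. The constant implied by $O(\cdot)$ may depend on $F$ and $r$ but not on $n$. *)

(* Defs.v *)
From mathcomp Require Import all_boot all_order all_algebra.
From mathcomp Require Import all_classical all_reals all_analysis.

Set Implicit Arguments.
Unset Strict Implicit.
Unset Printing Implicit Defensive.

Record sgraph := SGraph {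
  vertex :> finType;
  adj : rel vertex;
  adj_sym : symmetric adj;
  adj_irr : irreflexive adj }.

Definition graph_contains (F G : sgraph) : Prop :=
  exists2 phi : F -> G, injective phi &
    forall x y : F, adj x y -> adj (phi x) (phi y).

Definition graph_free (F G : sgraph) : Prop := ~ graph_contains F G.

Section Complete.
Variable r : nat.
Let Kadj : rel 'I_r := fun x y => x != y.

Fact Kadj_sym : symmetric Kadj.
Proof. by move=> x y; rewrite /Kadj eq_sym. Qed.

Fact Kadj_irr : irreflexive Kadj.
Proof. by move=> x; rewrite /Kadj eqxx. Qed.

Definition complete_graph : sgraph := SGraph Kadj_sym Kadj_irr.
End Complete.

Section Induced.
Variables (G : sgraph) (S : {set G}).
Let Iadj : rel {x : G | x \in S} := fun x y => adj (val x) (val y).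

Fact Iadj_sym : symmetric Iadj.
Proof. by move=> x y; rewrite /Iadj adj_sym. Qed.

Fact Iadj_irr : irreflexive Iadj.
Proof. by move=> x; rewrite /Iadj adj_irr. Qed.

Definition induced_graph : sgraph := SGraph Iadj_sym Iadj_irr.
End Induced.

Definition always_has (F H : sgraph) (n m : nat) : Prop :=
  forall G : sgraph, #|G| = n -> graph_free H G ->
    exists2 S : {set G}, #|S| = m & graph_free F (induced_graph S).

(* This is f_{F,H}(n).  An induced subgraph of an n-vertex graph has at most n
   vertices, so m <= n is no restriction when there is an H-free graph on n
   vertices (e.g. the edgeless one if H has an edge).  In that case, 0 appears
   as a junk value (no m qualifies) only for the F with no vertex. *)
Definition max_free_order (F H : sgraph) (n : nat) : nat :=
  \max_(m < n.+1 | `[< always_has F H n m >]) m.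

(* Main.v *)
(* Idea.  Let t = #|F|.  The points are those of the affine plane over a field K with q = Q ^ L
   elements, Q = 3 ^ j, and D is a set of Q ^ (4 t) slopes such that no four points in general
   position are pairwise joined by lines with slope in D; a maximal such D is large, because by
   Desargues' involution theorem each missing slope is a root of one of few quadratic polynomials.
   On every line with slope in D the points get labels in F, and two points of the line are
   adjacent if their labels are.  Among r pairwise adjacent points no four are in general position,
   so r - 1 of them lie on one line, and their labels span a K_(r-1) in F: there is no K_r.

   For random labels every large set of points contains many collinear sets of points carrying all
   labels.  Two points are on at most one line, so a hypergraph container argument encloses every
   set of points without an F supported by a single line in one of few sets of q Q points.  Under a
   random map from Q ^ (2 L - 5) vertices to the plane no set of Q ^ (L - 3) vertices is sent into
   one of these containers, and Q ^ (L - 3) is the power 1 / 2 - 1 / (2 (2 L - 5)) of the number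
   of vertices. *)
Require Import Defs.
From mathcomp Require Import all_boot all_order all_algebra all_field.
From mathcomp Require Import zify ring.

Set Implicit Arguments.
Unset Strict Implicit.
Unset Printing Implicit Defensive.

(** * Counting *)

Lemma subset_of_card (T : finType) (A : {set T}) k : k <= #|A| ->
  exists2 B : {set T}, B \subset A & #|B| = k.
Proof.
move=> kA; exists [set x in take k (enum A)].
  by apply/subsetP => x; rewrite inE => /mem_take; rewrite mem_enum.
rewrite cardsE (card_uniqP _) ?take_uniq ?enum_uniq //.
by rewrite size_takel // -cardE.
Qed.

(** Bernoulli's inequality for [(1 - 1/(m+1)) ^ k], cleared of denominators; for [k > m] the
    truncated difference makes the left side zero. *)
Lemma bernoulli_expn k m : m.+1 ^ k * (m.+1 - k) <= m.+1 * m ^ k.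
Proof.
elim: k => [|k IH]; first by rewrite !expn0 subn0 mulnC.
rewrite !expnSr mulnA; apply: leq_trans (leq_mul IH (leqnn m)).
rewrite -!mulnA leq_mul2l; apply/orP; right; nia.
Qed.

Lemma expn_succ_le2 k m : 2 * k <= m.+1 -> m.+1 ^ k <= 2 * m ^ k.
Proof.
move=> km; rewrite -(@leq_pmul2l m.+1) //.
by have := bernoulli_expn k m; nia.
Qed.

(** The exponent splits into two halves, each at most [(m + 1) / 2], and each half contributes a
    factor at most 2. *)
Lemma expn_succ_le4 m : m.+1 ^ m <= 4 * m ^ m.
Proof.
rewrite -{2 4}(subnK (leq_div m 2)) !expnD -[4]/(2 * 2) mulnACA.
by apply: leq_mul; apply: expn_succ_le2; lia.
Qed.

Lemma card_bigcup_disjoint (I T : finType) (J : {set I}) (f : I -> {set T}) :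
    {in J &, forall i j, i != j -> [disjoint f i & f j]} ->
  #|\bigcup_(i in J) f i| = \sum_(i in J) #|f i|.
Proof.
move=> dis; pose g i := if i \in J then f i else set0.
have -> : \bigcup_(i in J) f i = \bigcup_i g i by rewrite [LHS]big_mkcond.
rewrite -sum1_card (@partition_disjoint_bigcup _ _ _ _ _ g) => [|i j ij]; last first.
  rewrite /g; case: ifP => iJ; last by rewrite -setI_eq0 set0I.
  by case: ifP => jJ; [apply: dis|rewrite -setI_eq0 setI0].
rewrite [RHS]big_mkcond; apply: eq_bigr => i _; rewrite sum1_card /g.
by case: ifP => //; rewrite cards0.
Qed.

Lemma card_bigcup_le (I T : finType) (J : {set I}) (f : I -> {set T}) :
  #|\bigcup_(i in J) f i| <= \sum_(i in J) #|f i|.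
Proof.
elim/big_rec2: _ => [|j s1 s2 _ IH]; first by rewrite cards0.
by apply: leq_trans (leq_card_setU _ _).1 _; rewrite leq_add2l.
Qed.

Lemma prod_if_const (A : finType) (P : pred A) x y :
  \prod_a (if P a then x else y) = x ^ #|[set a | P a]| * y ^ (#|A| - #|[set a | P a]|).
Proof.
rewrite (bigID P) /=; congr (_ * _).
  by rewrite -prod_nat_const; apply: eq_big => [a|a ->]; rewrite ?inE.
have -> : #|A| - #|[set a | P a]| = #|~: [set a | P a]| by rewrite [RHS]cardsCs setCK.
rewrite -prod_nat_const; apply: eq_big => [a|a /negbTE ->] //.
by rewrite !inE.
Qed.

Lemma leq_exp2rW m n e : m <= n -> m ^ e <= n ^ e.
Proof. by case: e => // e mn; rewrite leq_exp2r. Qed.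

(* Chernoff bound, with weight 1 for each match and 2 for each other place. *)
Lemma few_matches (A : finType) t (tgt : A -> option 'I_t) C n :
    32 * (2 * t).-1 ^ C <= (2 * t) ^ C -> C * n <= #|[set a | tgt a]| ->
  #|[set f : {ffun A -> 'I_t} | #|[set a | tgt a == Some (f a)]| <= n]| * 16 ^ n
    <= t ^ #|A|.
Proof.
move=> hC hn; set E := [set f | _]; set s := #|[set a | tgt a]| in hn.
pose wt a (j : 'I_t) := if tgt a == Some j then 1 else 2.
have wtE a : \sum_j wt a j = if tgt a then (2 * t).-1 else 2 * t.
  rewrite /wt; case: (tgt a) => [j|] /=; last by rewrite sum_nat_const card_ord mulnC.
  rewrite (bigD1 j) //= eqxx.
  under eq_bigr => i ij.
    rewrite ifF; last by apply/negbTE; apply: contra ij => /eqP[->].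
    over.
  rewrite sum_nat_const cardC1 card_ord; case: t j {tgt E s hn wt hC} => [[]//|t] j /=; lia.
have tot : \sum_(f : {ffun A -> 'I_t}) \prod_a wt a (f a) =
    (2 * t).-1 ^ s * (2 * t) ^ (#|A| - s).
  by rewrite -bigA_distr_bigA; under eq_bigr do rewrite wtE; rewrite prod_if_const.
have sA : s <= #|A| by apply: max_card.
have C0 : 0 < C by rewrite lt0n; apply: contraTneq hC => ->; rewrite !expn0.
have nA : n <= #|A| by apply: leq_trans sA; apply: leq_trans hn; rewrite leq_pmull.
(* A map with at most [n] matches has weight at least [2 ^ (#|A| - n)], since every other place
   counts 2. *)
have low : #|E| * 2 ^ (#|A| - n) <= (2 * t).-1 ^ s * (2 * t) ^ (#|A| - s).
  rewrite -tot -sum_nat_const [X in _ <= X](bigID (mem E)) /=.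
  apply: leq_trans (leq_addr _ _); apply: leq_sum => f; rewrite inE => fE.
  by rewrite prod_if_const exp1n mul1n leq_pexp2l // leq_sub2l.
have up : 32 ^ n * ((2 * t).-1 ^ s * (2 * t) ^ (#|A| - s)) <= (2 * t) ^ #|A|.
  have -> : (2 * t) ^ #|A| = (2 * t) ^ (C * n) * ((2 * t) ^ (s - C * n) * (2 * t) ^ (#|A| - s)).
    by rewrite -!expnD; congr (_ ^ _); lia.
  have -> : (2 * t).-1 ^ s = ((2 * t).-1 ^ C) ^ n * (2 * t).-1 ^ (s - C * n).
    by rewrite -expnM -expnD; congr (_ ^ _); lia.
  rewrite -mulnA mulnA -expnMn; apply: leq_mul; first by rewrite expnM leq_exp2rW.
  by rewrite leq_mul2r leq_exp2rW ?orbT ?leq_pred //.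
(* Of the factor [32 ^ n], a part [2 ^ n] pays for the matched places and [16 ^ n] remains. *)
rewrite -(@leq_pmul2r (2 ^ #|A|)) ?expn_gt0 // -expnMn [t * 2]mulnC.
apply: leq_trans up; rewrite -{1}(subnK nA) expnD -[32]/(16 * 2) expnMn.
have -> : #|E| * 16 ^ n * (2 ^ (#|A| - n) * 2 ^ n) =
  16 ^ n * 2 ^ n * (#|E| * 2 ^ (#|A| - n)) by ring.
by rewrite leq_mul2l low orbT.
Qed.

(* [#|Bad X| <= #|U| / (4 #|T|)^#|X|] and [sum over X of (4 #|T|)^-#|X|] is less than 2. *)
Lemma union_bound (T U : finType) (Bad : {set T} -> {set U}) : 0 < #|U| ->
    (forall X, X != set0 -> #|Bad X| * (4 * #|T|) ^ #|X| <= #|U|) ->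
  exists u, forall X, X != set0 -> u \notin Bad X.
Proof.
move=> U0 bad; set y := 4 * #|T| in bad.
pose I := [set X : {set T} | X != set0].
have [cov|] := boolP ([set: U] \subset \bigcup_(X in I) Bad X); last first.
  case/subsetPn => u _ uB; exists u => X X0; apply: contra uB => uX.
  by apply/bigcupP; exists X; rewrite ?inE.
have [T0|T0] := posnP #|T|.
  have [u _] := card_gt0P U0; exists u => X /set0Pn[x _].
  by have := fintype0 x T0.
have y0 : 0 < y by rewrite muln_gt0.
have := leq_trans (subset_leq_card cov) (card_bigcup_le _ _); rewrite cardsT.
rewrite -(@leq_pmul2r (y ^ #|T|)) ?expn_gt0 ?y0 // big_distrl /= => h1.
have h2 : \sum_(X in I) #|Bad X| * y ^ #|T| <= \sum_(X in I) #|U| * y ^ (#|T| - #|X|).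
  apply: leq_sum => X; rewrite inE => X0.
  rewrite -{1}(subnK (max_card (mem X))) expnD mulnCA mulnC leq_mul2r bad ?orbT //.
(* The binomial theorem for [(1 + y) ^ #|T|], expanded over subsets. *)
have h3 : y ^ #|T| + \sum_(X in I) y ^ (#|T| - #|X|) = y.+1 ^ #|T|.
  transitivity (\sum_(X : {set T}) y ^ (#|T| - #|X|)).
    rewrite [RHS](bigD1 set0) //= cards0 subn0; congr (_ + _).
    by apply: eq_bigl => X; rewrite inE.
  have -> : y.+1 ^ #|T| = \prod_(i : T) (1 + y) by rewrite prod_nat_const.
  rewrite (bigA_distr _ _ (fun=> 1) (fun=> y)) /=.
  by apply: eq_bigr => X _; rewrite prod_if_const exp1n mul1n; congr (_ ^ (_ - _)); apply: eq_card => x; rewrite inE.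
(* [(1 + 1/y) ^ y] is at most 4, less than [2 ^ 4], and [y = 4 * #|T|]. *)
have h4 : y.+1 ^ #|T| < 2 * y ^ #|T|.
  rewrite ltnNge; apply/negP => h; have := expn_succ_le4 y.
  have e : y = #|T| * 4 by rewrite mulnC.
  rewrite {2 4}e !expnM.
  move: h; set a := y.+1 ^ _; set b := y ^ _ => h.
  have b0 : 0 < b by rewrite expn_gt0 y0.
  have : (2 * b) ^ 4 <= a ^ 4 by rewrite leq_exp2r.
  rewrite expnMn => h5 h6; have := leq_trans h5 h6.
  by rewrite leq_pmul2r // expn_gt0 b0.
have := leq_trans h1 h2; rewrite -big_distrr /= leq_pmul2l //.
by move=> ha; move: h4; rewrite -h3 mul2n -addnn ltn_add2l ltnNge ha.
Qed.

(** * Slopes without quadrangles *)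

Import GRing.Theory.

Section Plane.
Local Open Scope ring_scope.
Variable K : finFieldType.
Implicit Types (a b c e : K) (P Q R : K * K) (D : {set K}).

(* Only non-vertical lines occur: [icpt a P] determines the line of slope [a] through [P]. *)
Definition icpt a P := P.2 - a * P.1.

Lemma icpt_neq a P Q : P != Q -> icpt a P = icpt a Q -> Q.1 - P.1 != 0.
Proof.
case: P Q => [x y] [x' y'] /=; rewrite /icpt /= => PQ h; rewrite subr_eq0.
apply: contra PQ => /eqP e; rewrite e in h *.
by rewrite xpair_eqE eqxx /=; apply/eqP; apply: (addIr _ h).
Qed.

Lemma icpt_diff a P Q : icpt a P = icpt a Q -> Q.2 - P.2 = a * (Q.1 - P.1).
Proof. by rewrite /icpt => h; rewrite mulrBr -[Q.2](subrK (a * Q.1)) -h; ring. Qed.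

Lemma icpt_slope a b P Q : P != Q -> icpt a P = icpt a Q -> icpt b P = icpt b Q -> a = b.
Proof.
move=> PQ ha hb; have x0 := icpt_neq PQ ha.
by apply: (mulIf x0); rewrite -(icpt_diff ha) -(icpt_diff hb).
Qed.

Definition joined D P Q := [exists a in D, icpt a P == icpt a Q].

(** Vertical lines can be left out: two distinct points of a vertical line are never [joined]. *)
Definition collinear P Q R :=
  [exists a, (icpt a P == icpt a Q) && (icpt a P == icpt a R)].

Definition quadrangle D P1 P2 P3 P4 :=
  [&& uniq [:: P1; P2; P3; P4],
      [&& joined D P1 P2, joined D P1 P3, joined D P1 P4,
          joined D P2 P3, joined D P2 P4 & joined D P3 P4] &
      [&& ~~ collinear P1 P2 P3, ~~ collinear P1 P2 P4,
          ~~ collinear P1 P3 P4 & ~~ collinear P2 P3 P4]].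

Definition quad_free D :=
  [forall P1, forall P2, forall P3, forall P4, ~~ quadrangle D P1 P2 P3 P4].

Lemma quad_freeP D : reflect (forall P1 P2 P3 P4, ~~ quadrangle D P1 P2 P3 P4) (quad_free D).
Proof.
apply: (iffP idP) => [/forallP h P1 P2 P3 P4|h].
  by have /forallP/(_ P2)/forallP/(_ P3)/forallP := h P1.
by do 4!apply/forallP => ?.
Qed.

Lemma joinedC D P Q : joined D P Q = joined D Q P.
Proof. by apply: eq_existsb => a; rewrite eq_sym. Qed.

Lemma joinedS D (E : {set K}) P Q : D \subset E -> joined D P Q -> joined E P Q.
Proof.
move=> /subsetP DE /existsP[a /andP[aD h]].
by apply/existsP; exists a; rewrite DE.
Qed.

Lemma quad_freeS D (E : {set K}) : D \subset E -> quad_free E -> quad_free D.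
Proof.
move=> DE /quad_freeP h; apply/quad_freeP => P1 P2 P3 P4; apply: contra (h P1 P2 P3 P4).
case/and3P => u /and5P[j1 j2 j3 j4 /andP[j5 j6]] c.
by apply/and3P; split=> //; rewrite (joinedS DE j1) (joinedS DE j2) (joinedS DE j3) (joinedS DE j4) (joinedS DE j5) (joinedS DE j6).
Qed.

Lemma collinear12 P Q R : collinear P Q R = collinear Q P R.
Proof.
apply: eq_existsb => a; rewrite [icpt a Q == icpt a P]eq_sym.
by case: eqP => //= ->.
Qed.

Lemma collinear23 P Q R : collinear P Q R = collinear P R Q.
Proof. by apply: eq_existsb => a; rewrite andbC. Qed.

(** The three adjacent transpositions generate all permutations of the vertices, so a side with a
    new slope can be moved to [P1 P2]. *)
Lemma quadrangle12 D P1 P2 P3 P4 : quadrangle D P1 P2 P3 P4 -> quadrangle D P2 P1 P3 P4.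
Proof.
case/and3P => u /and5P[j1 j2 j3 j4 /andP[j5 j6]] /and4P[c1 c2 c3 c4].
apply/and3P; split.
- by rewrite (perm_uniq (s2 := [:: P1; P2; P3; P4])) //; apply/permP => f /=; rewrite addnCA.
- by rewrite joinedC j1 j4 j5 j2 j3.
by rewrite collinear12 c1 collinear12 c2 c4.
Qed.

Lemma quadrangle23 D P1 P2 P3 P4 : quadrangle D P1 P2 P3 P4 -> quadrangle D P1 P3 P2 P4.
Proof.
case/and3P => u /and5P[j1 j2 j3 j4 /andP[j5 j6]] /and4P[c1 c2 c3 c4].
apply/and3P; split.
- rewrite (perm_uniq (s2 := [:: P1; P2; P3; P4])) // perm_cons.
  by apply/permP => f /=; rewrite addnCA.
- by rewrite [joined D P3 P2]joinedC j1 j2 j3 j4 j5 j6.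
by rewrite collinear23 c1 c3 c2 collinear12 c4.
Qed.

Lemma quadrangle34 D P1 P2 P3 P4 : quadrangle D P1 P2 P3 P4 -> quadrangle D P1 P2 P4 P3.
Proof.
case/and3P => u /and5P[j1 j2 j3 j4 /andP[j5 j6]] /and4P[c1 c2 c3 c4].
apply/and3P; split.
- rewrite (perm_uniq (s2 := [:: P1; P2; P3; P4])) // !perm_cons.
  by apply/permP => f /=; rewrite addnCA.
- by rewrite [joined D P4 P3]joinedC j1 j2 j3 j4 j5 j6.
by rewrite c2 c1 /= collinear23 c3 collinear23 c4.
Qed.

(* If [p] holds, the slope opposite to [x] is [x] itself. *)
Definition quad_val (p : bool) a' b b' c c' (x : K) :=
  let a' := if p then x else a' in
  (b - c') * (x - b') * (c - a') - (x - c') * (c - b') * (b - a').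

(* Desargues' involution theorem for the slopes of a quadrangle. *)
Lemma quad_slopes P1 P2 P3 P4 a a' b b' c c' : uniq [:: P1; P2; P3; P4] ->
    icpt a P1 = icpt a P2 -> icpt a' P3 = icpt a' P4 ->
    icpt b P1 = icpt b P3 -> icpt b' P2 = icpt b' P4 ->
    icpt c P1 = icpt c P4 -> icpt c' P2 = icpt c' P3 ->
  quad_val false a' b b' c c' a = 0.
Proof.
rewrite /= !inE !negb_or => /and4P[/and3P[n12 n13 n14] _ _ _] ha ha' hb hb' hc hc'.
have := icpt_neq n12 ha; have := icpt_neq n13 hb; have := icpt_neq n14 hc.
move: (icpt_diff ha) (icpt_diff ha') (icpt_diff hb) (icpt_diff hb') (icpt_diff hc) (icpt_diff hc').
set u := P2.1 - P1.1; set v := P3.1 - P1.1; set w := P4.1 - P1.1.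
have -> : P4.1 - P3.1 = w - v by rewrite /w /v; ring.
have -> : P4.1 - P2.1 = w - u by rewrite /w /u; ring.
have -> : P3.1 - P2.1 = v - u by rewrite /v /u; ring.
move=> ea ea' eb eb' ec ec' w0 v0 u0.
(* [e1], [e2] and [e3] close the triangles [P1 P2 P3], [P1 P2 P4] and [P1 P3 P4]; multiplying them
   eliminates the differences [u], [v], [w]. *)
have e1 : u * (a - c') = v * (b - c').
  have : b * v - a * u = c' * (v - u) by rewrite -ea -eb -ec'; ring.
  by move=> h; apply/eqP; rewrite -subr_eq0 -(subrr (c' * (v - u))) -{2}h; apply/eqP; ring.
have e2 : u * (a - b') = w * (c - b').
  have : c * w - a * u = b' * (w - u) by rewrite -ea -ec -eb'; ring.
  by move=> h; apply/eqP; rewrite -subr_eq0 -(subrr (b' * (w - u))) -{2}h; apply/eqP; ring.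
have e3 : w * (c - a') = v * (b - a').
  have : c * w - b * v = a' * (w - v) by rewrite -eb -ec -ea'; ring.
  by move=> h; apply/eqP; rewrite -subr_eq0 -(subrr (a' * (w - v))) -{1}h; apply/eqP; ring.
apply: (mulfI u0); apply: (mulfI v0); apply: (mulfI w0).
rewrite /quad_val !mulr0.
transitivity ((v * (b - c')) * (u * (a - b')) * (w * (c - a')) -
  (u * (a - c')) * (w * (c - b')) * (v * (b - a'))); first by ring.
by rewrite -e1 e2 e3; ring.
Qed.

Lemma quadratic_zeros (A B C y : K) : A * y ^+ 2 + B * y + C != 0 ->
  (#|[set x | (A * x ^+ 2 + B * x + C == 0)%R]| <= 2)%N.
Proof.
move=> y0; pose p := Poly [:: C; B; A].
have pE x : p.[x] = A * x ^+ 2 + B * x + C by rewrite horner_Poly /=; ring.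
have p0 : p != 0 by apply: contra y0 => /eqP p0; rewrite -pE p0 horner0.
rewrite cardE -ltnS; apply: leq_trans (max_poly_roots p0 _ (enum_uniq _)) (size_Poly _).
by apply/allP => x; rewrite mem_enum inE /root pE.
Qed.

(** More than two zeros mean that the polynomial vanishes identically; the empty set is then a
    default that keeps the size bound unconditional. *)
Definition quad_zeros p a' b b' c c' : {set K} :=
  let Z := [set x | quad_val p a' b b' c c' x == 0] in if (#|Z| <= 2)%N then Z else set0.

Lemma quad_zerosP p a' b b' c c' x y : quad_val p a' b b' c c' x = 0 ->
  quad_val p a' b b' c c' y != 0 -> x \in quad_zeros p a' b b' c c'.
Proof.
move=> hx hy; rewrite /quad_zeros ifT ?inE ?hx ?eqxx //.
pose A := if p then (c - b') - (b - c') else 0.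
pose B := if p then (b - c') * (c + b') - (c - b') * (b + c')
  else (b - c') * (c - a') - (c - b') * (b - a').
pose C := if p then c' * (c - b') * b - (b - c') * b' * c
  else c' * (c - b') * (b - a') - b' * (b - c') * (c - a').
have E z : quad_val p a' b b' c c' z = A * z ^+ 2 + B * z + C.
  by rewrite /quad_val /A /B /C; case: p {hx hy A B C}; ring.
rewrite E in hy; have := quadratic_zeros hy.
by under eq_finset do rewrite -E.
Qed.

Lemma quad_zeros_le2 p a' b b' c c' : (#|quad_zeros p a' b b' c c'| <= 2)%N.
Proof. by rewrite /quad_zeros; case: ifP; rewrite ?cards0. Qed.

(** Take a line with the most points of [S]. If two points [x], [y] of [S] are off it, the line
    [x y] meets it in at most one point of [S], and two other points of the long line form a
    quadrangle with [x] and [y]. *)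
Lemma clique_line D (S : {set K * K}) : quad_free D -> (4 <= #|S|)%N ->
    {in S &, forall P Q, P != Q -> joined D P Q} ->
  exists a P, a \in D /\ (#|S|.-1 <= #|[set Q in S | icpt a Q == icpt a P]|)%N.
Proof.
move=> Dfree S4 jS; pose ln (u : K * (K * K)) := [set Q in S | icpt u.1 Q == icpt u.1 u.2].
have /card_gt1P[P0 [Q0 [P0S Q0S n0]]] : (1 < #|S|)%N by apply: leq_trans S4.
have /existsP[a0 /andP[a0D h0]] := jS _ _ P0S Q0S n0.
have := @arg_maxnP _ (a0, P0) (fun u => (u.1 \in D) && (u.2 \in S)) (fun u => #|ln u|).
rewrite /= a0D P0S => /(_ isT)[[a P] /= /andP[aD PS] lmax].
exists a, P; split=> //; rewrite leqNgt; apply/negP => small.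
have sz2 : (2 <= #|ln (a, P)|)%N.
  apply: leq_trans (lmax (a0, P0) _); last by rewrite /= a0D P0S.
  by apply/card_gt1P; exists P0, Q0; rewrite !inE /= P0S Q0S eqxx eq_sym h0.
have lnS u : ln u \subset S by apply/subsetP => Q; rewrite inE => /andP[].
have : (1 < #|S :\: ln (a, P)|)%N.
  rewrite cardsD (setIidPr (lnS _)).
  have : (#|ln (a, P)| < #|S|.-1)%N := small.
  by lia.
case/card_gt1P => x [y []]; rewrite !inE /= => /andP[xl xS] /andP[yl yS] xy.
rewrite xS /= in xl; rewrite yS /= in yl.
have /existsP[b /andP[bD /eqP hxy]] := jS _ _ xS yS xy.
have meet : (#|ln (a, P) :&: ln (b, x)| <= 1)%N.
  rewrite leqNgt; apply/negP => /card_gt1P[p [q []]]; rewrite !inE /=.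
  move=> /andP[/andP[pS /eqP pa] /andP[_ /eqP pb]] /andP[/andP[qS /eqP qa] /andP[_ /eqP qb]] pq.
  have ab : a = b by apply: (icpt_slope pq); [rewrite pa qa|rewrite pb qb].
  by rewrite -pa ab pb eqxx in xl.
have : (1 < #|ln (a, P) :\: ln (b, x)|)%N.
  rewrite cardsD; have [m0|m0] := posnP #|ln (a, P) :&: ln (b, x)|; first by rewrite m0 subn0.
  have [z] := card_gt0P m0; rewrite !inE /= => /andP[/andP[zS za] /andP[_ zb]].
  (* If the two lines share a point [z] of [S], the line [x y] has three points, so by maximality
     the long line has three as well. *)
  suff : (3 <= #|ln (b, x)|)%N.
    move=> /leq_trans/(_ (lmax (b, x) _)) /=; rewrite bD xS => /(_ isT) l3.
    by rewrite ltn_subRL (leq_ltn_trans (leq_add meet (leqnn 1))).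
  apply: leq_trans (_ : #|[set x; y; z]| <= _)%N; last first.
    by apply/subset_leq_card/subsetP => w; rewrite !inE => /orP[/orP[]|] /eqP ->; rewrite /= ?xS ?yS ?zS ?zb //= -?hxy eqxx.
  have xz : x != z by apply: contra xl => /eqP ->.
  have yz : y != z by apply: contra yl => /eqP ->.
  by rewrite -setUA cardsU1 cards2 !inE negb_or xy xz yz.
case/card_gt1P => p [q []]; rewrite !inE /= => /andP[pb /andP[pS /eqP pa]].
move=> /andP[qb /andP[qS /eqP qa]] pq; rewrite pS /= in pb; rewrite qS /= in qb.
case/negP: (quad_freeP _ Dfree x y p q).
have ne u v : icpt a u != icpt a P -> icpt a v = icpt a P -> u != v.
  by move=> hu hv; apply: contra hu => /eqP ->; rewrite hv.
have xp := ne _ _ xl pa; have xq := ne _ _ xl qa.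
have yp := ne _ _ yl pa; have yq := ne _ _ yl qa.
apply/and3P; split.
- by rewrite /= !inE !negb_or xy xp xq yp yq pq.
- by rewrite !jS.
have nxy r : icpt b r != icpt b x -> ~~ collinear x y r.
  move=> hr; apply: contra hr => /existsP[c /andP[/eqP h1 /eqP h2]].
  by rewrite (icpt_slope xy hxy h1) h2.
have npq u : icpt a u != icpt a P -> ~~ collinear u p q.
  move=> hu; apply: contra hu => /existsP[c /andP[/eqP h1 /eqP h2]].
  have ac : a = c by apply: (icpt_slope pq); [rewrite pa qa|rewrite -h1 h2].
  by rewrite ac h1 -ac pa.
by rewrite !nxy ?npq.
Qed.

Hypothesis two_neq0 : 2%:R != 0 :> K.

(** By non-collinearity the four sides sharing one vertex with [P1 P2] have slopes other than [e],
    hence in [D]; only the opposite side may have slope [e] again, which is the case [p = true]. *)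
Lemma quad_new_slope D e P1 P2 P3 P4 : quadrangle (e |: D) P1 P2 P3 P4 ->
    icpt e P1 = icpt e P2 ->
  exists p a' b b' c c', [&& a' \in D, b \in D, b' \in D, c \in D & c' \in D] /\
    e \in quad_zeros p a' b b' c c'.
Proof.
move=> /and3P[u /and5P[_ j13 j14 j23 /andP[j24 j34]] /and4P[c123 c124 c134 c234]] h12.
move: (u); rewrite /= !inE !negb_or => /and4P[/and3P[n12 n13 n14] /andP[n23 n24] n34 _].
have nc P Q R x y : ~~ collinear P Q R -> icpt x P = icpt x Q -> icpt y P = icpt y R -> x != y.
  move=> nPQR h h'; apply: contra nPQR => /eqP xy; apply/existsP; exists x.
  by rewrite h eqxx -h xy h' eqxx.
have inD P Q : joined (e |: D) P Q -> icpt e P != icpt e Q ->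
    exists2 x, x \in D & icpt x P = icpt x Q.
  case/existsP => x /andP[]; rewrite !inE => /orP[/eqP -> -> //|xD /eqP h] _.
  by exists x.
have nPR P Q R : ~~ collinear P Q R -> icpt e P = icpt e Q -> icpt e P != icpt e R.
  by move=> nPQR h; apply: contra nPQR => /eqP h'; apply/existsP; exists e; rewrite h -{1}h -h' h !eqxx.
have [b bD hb] := inD _ _ j13 (nPR _ _ _ c123 h12).
have [c cD hc] := inD _ _ j14 (nPR _ _ _ c124 h12).
have c213 : ~~ collinear P2 P1 P3 by rewrite -collinear12.
have c214 : ~~ collinear P2 P1 P4 by rewrite -collinear12.
have [c' c'D hc'] := inD _ _ j23 (nPR _ _ _ c213 (esym h12)).
have [b' b'D hb'] := inD _ _ j24 (nPR _ _ _ c214 (esym h12)).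
have bc : b != c by apply: nc c134 hb hc.
have b'c' : b' != c' by rewrite eq_sym; apply: nc c234 hc' hb'.
have cb' : c != b'.
  by apply: (@nc P4 P1 P2 _ _ _ (esym hc) (esym hb')); rewrite collinear12 collinear23.
have eb : e != b by apply: nc c123 h12 hb.
have ec : e != c by apply: nc c124 h12 hc.
have zero a' : icpt a' P3 = icpt a' P4 -> quad_val false a' b b' c c' e = 0.
  by move=> ha'; apply: (quad_slopes u).
have [h34|h34] := boolP (icpt e P3 == icpt e P4); last first.
  have [a' a'D ha'] := inD _ _ j34 h34.
  have ba' : b != a' by apply: (@nc P3 P1 P4 _ _ _ (esym hb) ha'); rewrite collinear12.
  exists false, a', b, b', c, c'; split; first by apply/and5P.
  (* At [b'] the first product vanishes, while the second is a product of nonzero differences of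
     slopes. *)
  apply: (quad_zerosP (y := b')); first exact: zero.
  by rewrite /quad_val subrr mulr0 mul0r sub0r oppr_eq0 !mulf_neq0 // subr_eq0.
(* The first [b] is a placeholder, since with [p] true the opposite slope is [e] itself. *)
exists true, b, b, b', c, c'; split; first by apply/and5P.
have z := zero _ (eqP h34).
have [bb'|bb'] := eqVneq b b'; last first.
  apply: (quad_zerosP (y := b')) => //.
  by rewrite /quad_val subrr mulr0 mul0r sub0r oppr_eq0 !mulf_neq0 // subr_eq0.
have [cc'|cc'] := eqVneq c c'; last first.
  apply: (quad_zerosP (y := c)) => //.
  by rewrite /quad_val subrr mulr0 sub0r oppr_eq0 !mulf_neq0 // subr_eq0.
(* All three pairs of opposite sides are parallel here: a Fano configuration, excluded because the
   characteristic is not 2. *)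
move: z; rewrite /quad_val -bb' -cc' => /eqP.
rewrite (_ : _ - _ = 2%:R * (b - c) * (e - b) * (c - e)); last by ring.
by rewrite !mulf_eq0 (negbTE two_neq0) !subr_eq0 (negbTE bc) (negbTE eb) eq_sym (negbTE ec).
Qed.

(** Take [D] maximal: a slope outside it creates a quadrangle, hence is one of at most 2 zeros for
    one of [2 * #|D| ^ 5] parameter tuples. This gives [#|K| <= #|D| + 4 * #|D| ^ 5]. *)
Lemma exists_quad_free : exists2 D : {set K}, quad_free D & (#|K| <= 5 * #|D| ^ 5)%N.
Proof.
have [|D maxD] := @ex_maxset K quad_free.
  exists set0; apply/quad_freeP => P1 P2 P3 P4; apply/negP.
  by case/and3P => _ /andP[/existsP[a]]; rewrite inE.
have [Dfree maxl] := maxsetP maxD; exists D => //.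
pose I := setX [set: bool] (setX D (setX D (setX D (setX D D)))).
pose Z (i : bool * (K * (K * (K * (K * K))))) :=
  let: (p, (a', (b, (b', (c, c'))))) := i in quad_zeros p a' b b' c c'.
have cover : [set: K] \subset D :|: \bigcup_(i in I) Z i.
  apply/subsetP => e _; rewrite inE; have [//|eD /=] := boolP (e \in D).
  have : ~~ quad_free (e |: D).
    apply: contra eD => /maxl <-; first exact: setU11.
    exact: subsetUr.
  move=> /forallPn[P1 /forallPn[P2 /forallPn[P3 /forallPn[P4]]]]; rewrite negbK => Q.
  suff [Q1 [Q2 [Q3 [Q4 [Q' h]]]]] : exists Q1 Q2 Q3 Q4,
      quadrangle (e |: D) Q1 Q2 Q3 Q4 /\ icpt e Q1 = icpt e Q2.
    have [p [a' [b [b' [c [c' [/and5P[? ? ? ? ?] ez]]]]]]] := quad_new_slope Q' h.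
    apply/bigcupP; exists (p, (a', (b, (b', (c, c'))))) => //.
    by rewrite !inE /=; apply/and5P; split=> //; apply/andP.
  have [/eqP h|h12] := boolP (icpt e P1 == icpt e P2); first by exists P1, P2, P3, P4.
  have [/eqP h|h13] := boolP (icpt e P1 == icpt e P3).
    by exists P1, P3, P2, P4; rewrite quadrangle23.
  have [/eqP h|h14] := boolP (icpt e P1 == icpt e P4).
    by exists P1, P4, P2, P3; rewrite quadrangle23 // quadrangle34.
  have [/eqP h|h23] := boolP (icpt e P2 == icpt e P3).
    by exists P2, P3, P1, P4; rewrite quadrangle23 // quadrangle12.
  have [/eqP h|h24] := boolP (icpt e P2 == icpt e P4).
    by exists P2, P4, P1, P3; rewrite quadrangle23 // quadrangle34 // quadrangle12.
  have [/eqP h|h34] := boolP (icpt e P3 == icpt e P4).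
    exists P3, P4, P1, P2; split=> //.
    by rewrite quadrangle23 // quadrangle34 // quadrangle12 // quadrangle23.
  case/negP: (quad_freeP _ Dfree P1 P2 P3 P4).
  have jD P R : joined (e |: D) P R -> icpt e P != icpt e R -> joined D P R.
    case/existsP => x /andP[]; rewrite !inE => /orP[/eqP -> -> //|xD h] _.
    by apply/existsP; exists x; rewrite xD.
  case/and3P: Q => u /and5P[j1 j2 j3 j4 /andP[j5 j6]] nc.
  by apply/and3P; split=> //; rewrite !jD.
have := subset_leq_card cover; rewrite cardsT => /leq_trans; apply.
apply: leq_trans (leq_card_setU _ _).1 _.
have : (#|\bigcup_(i in I) Z i| <= \sum_(i in I) 2)%N.
  apply: leq_trans (_ : \sum_(i in I) #|Z i| <= _)%N.
    exact: card_bigcup_le.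
  by apply: leq_sum => -[p [a' [b [b' [c c']]]]] _; apply: quad_zeros_le2.
rewrite sum_nat_const !cardsX cardsT card_bool.
move: (#|D|) => d h; apply: leq_trans (leq_add (leqnn d) h) _.
by case: d {h} => // d; rewrite !expnS expn0; nia.
Qed.

End Plane.

(** * Containers for linear block systems *)

Section Covers.
Variable T : finType.
Implicit Types (P : {set T} -> Prop) (small : pred {set T}).

Definition covered P n small : Prop :=
  exists cs : seq {set T}, [/\ size cs <= n, all small cs &
    forall S, P S -> exists2 C, C \in cs & S \subset C].

Lemma covered_imply P Q n m small : (forall S, P S -> Q S) -> n <= m ->
  covered Q n small -> covered P m small.
Proof.
move=> PQ nm [cs [sz al cov]]; exists cs; split=> //; first exact: leq_trans nm.
by move=> S /PQ /cov.
Qed.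

Lemma covered_seq (I : eqType) (s : seq I) (P : I -> {set T} -> Prop) n small :
    (forall i, i \in s -> covered (P i) n small) ->
  covered (fun S => exists2 i, i \in s & P i S) (size s * n) small.
Proof.
elim: s => [|i s IH] covs; first by exists [::]; split=> // S [].
have [|cs [sz al cov]] := IH; first by move=> k ks; apply: covs; rewrite inE ks orbT.
have [cs' [sz' al' cov']] := covs i (mem_head _ _).
exists (cs' ++ cs); split.
- by rewrite size_cat mulSn leq_add.
- by rewrite all_cat al'.
move=> S [k ks PkS]; have [ki|ki] := eqVneq k i.
  by rewrite ki in PkS; have [C Cin sub] := cov' S PkS; exists C; rewrite // mem_cat Cin.
have [|C Cin sub] := cov S; last by exists C; rewrite // mem_cat Cin orbT.
by exists k => //; move: ks; rewrite inE (negbTE ki).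
Qed.

(** A set that avoids [H] lies in the single container [C]; any other one contains some [v] in [H],
    and there are at most [#|T|] choices of [v]. *)
Lemma covered_branch P n small (H C : {set T}) :
    small C -> (forall S, P S -> [disjoint S & H] -> S \subset C) ->
    (forall v, v \in H -> covered (fun S => P S /\ v \in S) n small) ->
  covered P (1 + #|T| * n) small.
Proof.
move=> smC PC covH.
have [|cs [sz al cov]] := @covered_seq _ (enum H) (fun v S => P S /\ v \in S) n small.
  by move=> v; rewrite mem_enum; apply: covH.
exists (C :: cs); split=> /=; last 1 first.
- move=> S PS; have [SH|] := boolP [disjoint S & H]; first by exists C; rewrite ?mem_head ?PC.
  case/pred0Pn => v /andP[vS vH]; have [|Y Ycs sub] := cov S.
    by exists v; rewrite ?mem_enum.
  by exists Y => //; rewrite inE Ycs orbT.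
- by rewrite add1n ltnS (leq_trans sz) // -cardE leq_mul2r max_card orbT.
- by rewrite smC.
Qed.

(** Each step replaces a container by at most [n] others, smaller by the factor [1 - 1/M]; the last
    hypothesis makes [K] steps suffice. Containers that are small earlier are kept. *)
Lemma covered_iter P n M x0 K (X : {set T}) : 0 < n -> 0 < M ->
    (forall X : {set T}, x0 < #|X| -> covered (fun S => P S /\ S \subset X) n
       (fun C => M * #|C| <= M.-1 * #|X|)) ->
    M.-1 ^ K * #|X| <= x0 * M ^ K ->
  covered (fun S => P S /\ S \subset X) (n ^ K) (fun C => #|C| <= x0).
Proof.
move=> n0 M0 step; elim: K X => [|K IH] X.
  rewrite !expn0 mul1n muln1 => X0; exists [:: X]; split; rewrite ?all_seq1 //.
  by move=> S [_ SX]; exists X; rewrite ?mem_head.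
case: (leqP #|X| x0) => [X0 _|X0 hX].
  exists [:: X]; split; rewrite ?all_seq1 ?expn_gt0 ?n0 //.
  by move=> S [_ SX]; exists X; rewrite ?mem_head.
have [cs [sz al cov]] := step X X0.
apply: covered_imply (@covered_seq _ cs (fun C S => P S /\ S \subset C) (n ^ K) _ _).
- by move=> S [PS SX]; have [C Ccs SC] := cov S (conj PS SX); exists C.
- by rewrite expnS leq_mul2r sz orbT.
move=> C /(allP al) MC; apply: IH.
rewrite -(leq_pmul2l M0) mulnCA (leq_trans (leq_mul (leqnn _) MC)) //.
by rewrite mulnA -expnSr (leq_trans hX) // expnS mulnCA.
Qed.

End Covers.

Section Blocks.
Variables (T Bk : finType).
Implicit Types (Bs : {set Bk}) (p : Bk -> nat -> {set T}).

Definition deg Bs p j u := #|[set B in Bs | u \in p B j]|.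

Lemma sum_deg Bs p j (A : {set T}) :
  \sum_(u in A) deg Bs p j u = \sum_(B in Bs) #|p B j :&: A|.
Proof.
under eq_bigr => u _.
  rewrite /deg -sum1dep_card big_mkcondr /=; over.
rewrite exchange_big /=; apply: eq_bigr => B _.
rewrite -sum1_card -big_mkcondr /=; apply: eq_bigl => u.
by rewrite inE andbC.
Qed.

Lemma sum_degT Bs p j : \sum_u deg Bs p j u = \sum_(B in Bs) #|p B j|.
Proof.
transitivity (\sum_(u in [set: T]) deg Bs p j u); first by apply: eq_bigl => u; rewrite inE.
by rewrite sum_deg; apply: eq_bigr => B _; rewrite setIT.
Qed.

End Blocks.

(* An independent set misses a part of every block.  At level [i] the remaining blocks are already
   hit in their parts [0, ..., i - 1]; they are, up to the factors [sg i] and [G i], a system of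
   blocks with parts of size [W] and degrees [Dl i].  Choosing [tau] points of an independent set
   leads to the next level, unless the set avoids a constant proportion of [X]. *)
Section Container.
Variables (T Bk : finType) (X : {set T}) (p0 : Bk -> nat -> {set T}).
Variables (t W q tau Lam C1 C2 M : nat) (Dl G : nat -> nat).
Let x := #|X|.
Let sg i := C2 * 2 ^ i.

Hypotheses (W0 : 0 < W) (C2_gt0 : 0 < C2) (Dl0 : forall i, i < t -> 0 < Dl i).
Hypotheses (qE : q = tau * Lam) (Wx : W * q <= x) (xW : x <= C1 * W * q).
Hypothesis DlS : forall i, i.+1 < t -> Dl i.+1 * Lam = 8 * t * G i * Dl i.
Hypothesis GS : forall i, i.+1 < t -> 64 * t * sg i * G i ^ 2 * C1 <= G i.+1.
Hypothesis GLam : forall i, i < t -> 4 * G i <= Lam.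
Hypothesis GM : forall i, i < t -> 4 * G i <= M.

Definition linear_blocks (Bs : {set Bk}) := forall u v B B' i i' j j',
  u != v -> B \in Bs -> B' \in Bs -> i < t -> i' < t -> j < t -> j' < t ->
  u \in p0 B i -> v \in p0 B j -> u \in p0 B' i' -> v \in p0 B' j' -> B = B'.

Variable B0 : {set Bk}.
Hypothesis lin : linear_blocks B0.
Hypothesis dis : forall B u i j, B \in B0 -> i < t -> j < t ->
  u \in p0 B i -> u \in p0 B j -> i = j.
Hypothesis p0W : forall B j, B \in B0 -> j < t -> #|p0 B j| <= W.
Hypothesis p0X : forall B j, B \in B0 -> j < t -> p0 B j \subset X.

Definition hits (S : {set T}) B j := [exists u in S, u \in p0 B j].

Definition indep (S : {set T}) := S \subset X /\
  forall B, B \in B0 -> exists2 j, j < t & ~~ hits S B j.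

Implicit Types (Bs : {set Bk}) (p : Bk -> nat -> {set T}) (S : {set T}).

(** By the bounds on the part sizes and the number of blocks, the average degree over [X] in every
    part [j] with [i <= j < t] is at least [Dl i / G i], so the maximal degree exceeds it by at most
    the factor [G i]. *)
Definition level_inv i Bs p := [/\ Bs \subset B0,
  forall B j, B \in Bs -> i <= j < t -> W <= sg i * #|p B j|,
  forall B j, B \in Bs -> i <= j < t -> p B j \subset p0 B j,
  forall j u, i <= j < t -> deg Bs p j u <= Dl i &
  Dl i * x * sg i <= G i * #|Bs| * W].

Definition level_fam i (Bs : {set Bk}) (S : {set T}) :=
  indep S /\ forall B j, B \in Bs -> j < i -> hits S B j.

Definition shrunk (C : {set T}) := M * #|C| <= M.-1 * x.

Lemma shrunk_compl (H : {set T}) g : H \subset X -> 4 * g <= M ->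
  x <= 4 * g * #|H| -> shrunk (X :\: H).
Proof.
move=> HX gM xH; rewrite /shrunk cardsD (setIidPr HX) -/x.
have hx : #|H| <= x by apply: subset_leq_card.
have : x <= M * #|H| by apply: leq_trans xH _; rewrite leq_mul2r gM orbT.
by case: (M) => [|m] //=; nia.
Qed.

(** At the last level only one part per block is not known to be hit, so an independent set avoids
    the union [U] of these parts. Double counting with degrees at most [Dl i] gives [U] at least
    [x / G i] points. *)
Lemma level_last i Bs p : i.+1 = t -> level_inv i Bs p -> covered (level_fam i Bs) 1 shrunk.
Proof.
move=> it [BsB0 szp pp0 degp big].
have i_t : i < t by rewrite -it.
have ii : i <= i < t by rewrite leqnn.
pose U := \bigcup_(B in Bs) p B i.
have UX : U \subset X.
  apply/bigcupsP => B BBs; have B0B := subsetP BsB0 _ BBs.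
  by apply: subset_trans (p0X B0B i_t); apply: pp0.
have xU : x <= G i * #|U|.
  have h1 : \sum_(B in Bs) #|p B i| <= #|U| * Dl i.
    rewrite -sum_degT (bigID (mem U)) /= [X in _ + X]big1 ?addn0.
      by rewrite -sum_nat_const; apply: leq_sum => u _; apply: degp.
    move=> u uU; apply: eq_card0 => B; rewrite inE; apply/negP => /andP[BBs up].
    by case/negP: uU; apply/bigcupP; exists B.
  have h2 : #|Bs| * W <= sg i * \sum_(B in Bs) #|p B i|.
    by rewrite big_distrr /= -sum_nat_const; apply: leq_sum => B /szp; apply.
  have s0 : 0 < sg i by rewrite muln_gt0 C2_gt0 expn_gt0.
  have d0 := Dl0 i_t.
  rewrite -(leq_pmul2l d0) -(leq_pmul2r s0) (leq_trans big) //.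
  rewrite -mulnA (leq_trans (leq_mul (leqnn _) h2)) //.
  rewrite (leq_trans (leq_mul (leqnn _) (leq_mul (leqnn _) h1))) //.
  by rewrite !mulnA; apply/eq_leq; ring.
exists [:: X :\: U]; split=> //.
  rewrite all_seq1; apply: (@shrunk_compl _ (G i)) => //; first exact: GM.
  by rewrite (leq_trans xU) // -mulnA leq_pmull.
move=> S [[SX indS] hit]; exists (X :\: U); first exact: mem_head.
rewrite subsetD SX disjoint_sym disjoint_subset /=; apply/subsetP => u.
case/bigcupP => B BBs up; rewrite inE; apply/negP => uS.
have B0B := subsetP BsB0 _ BBs.
have [j jt] := indS B B0B; case/negP.
case: (ltnP j i) => [ji|ij]; first exact: hit.
have -> : j = i by apply/eqP; rewrite eqn_leq ij -ltnS it jt.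
by apply/existsP; exists u; rewrite uS (subsetP (pp0 _ _ BBs ii)).
Qed.

(** [Bs'] collects blocks hit in part [i] by the [k] points chosen so far; each choice adds at most
    [Dl i] and at least [Dl i / (4 * G i)] of them. Part sizes and degrees already obey the bounds
    of level [i.+1]. *)
Definition round_inv i k Bs p Bs' p' := [/\ Bs' \subset Bs,
  #|Bs'| <= k * Dl i, k * Dl i <= 4 * G i * #|Bs'| &
  [/\ forall B j, B \in Bs' -> i < j < t -> W <= sg i.+1 * #|p' B j|,
  forall B j, B \in Bs' -> i < j < t -> p' B j \subset p B j &
  forall j u, i < j < t -> deg Bs' p' j u <= Dl i.+1]].

Definition round_fam i Bs Bs' (S : {set T}) :=
  level_fam i Bs S /\ forall B, B \in Bs' -> hits S B i.

Section Pick.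
Variables (i k : nat) (Bs Bs' : {set Bk}) (p p' : Bk -> nat -> {set T}).
Hypotheses (it : i.+1 < t) (kt : k <= tau).
Hypotheses (Hl : level_inv i Bs p) (Hr : round_inv i k Bs p Bs' p').

(* Points of maximal degree are removed from the parts of the blocks that are added later; by
   linearity one choice increases each degree by at most one. *)
Let Sat j := [set u | Dl i.+1 <= deg Bs' p' j u].
Let Good := [set B in Bs :\: Bs' |
  [forall j : 'I_t, (i < j) ==> (W <= sg i.+1 * #|p B j :\: Sat j|)]].
Let H := [set v in X | Dl i <= 4 * G i * deg Good p i v].

Lemma Lam_gt0 : 0 < G i -> 0 < Lam.
Proof. by move=> Gi; apply: leq_trans (GLam (ltnW it)); rewrite muln_gt0. Qed.

(** Two kinds of blocks are lost, each at most a quarter of [Bs]: those already in [Bs'], and those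
    for which removing [Sat] pushes a later part below its size bound. *)
Lemma card_good : #|Bs| <= 2 * #|Good|.
Proof.
have [BsB0 szp pp0 degp big] := Hl; have [sBB cB' _ [_ sp' degp']] := Hr.
have i_t : i < t by apply: ltnW.
set g := #|Bs| in big *.
have d0 := Dl0 i_t; have d1 := Dl0 it.
have [x0|x0] := posnP x.
  have Bs0 : Bs = set0.
    apply/setP => B; rewrite inE; apply/negP => BBs.
    have := szp B i BBs; rewrite leqnn i_t => /(_ isT).
    have B0B := subsetP BsB0 _ BBs.
    have := subset_trans (pp0 B i BBs _) (p0X B0B i_t); rewrite leqnn i_t.
    by move=> /(_ isT) /subset_leq_card; rewrite -/x x0 leqn0 => /eqP ->; lia.
  by rewrite /g Bs0 cards0.
have s0 : 0 < sg i by rewrite muln_gt0 C2_gt0 expn_gt0.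
have gG : sg i * q * Dl i <= G i * g.
  rewrite -(leq_pmul2r W0) (leq_trans _ big) //.
  have -> : Dl i * x * sg i = sg i * Dl i * x by ring.
  have -> : sg i * q * Dl i * W = sg i * Dl i * (W * q) by ring.
  by rewrite leq_mul2l Wx orbT.
have G0 : 0 < G i.
  rewrite lt0n; apply/eqP => Gi0; move: big; rewrite Gi0 !mul0n leqn0.
  by rewrite !muln_eq0; lia.
have L0 := Lam_gt0 G0.
have used : 4 * #|Bs'| <= g.
  rewrite -(leq_pmul2l G0) (leq_trans _ gG) //.
  have h : #|Bs'| <= tau * Dl i by apply: leq_trans cB' _; rewrite leq_mul2r kt orbT.
  have h4 := GLam i_t.
  have e1 : (4 * G i) * #|Bs'| <= Lam * (tau * Dl i) by apply: leq_mul.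
  have e2 : q * Dl i <= sg i * q * Dl i by rewrite -mulnA leq_pmull.
  by rewrite qE in e2 *; lia.
pose Bad j := [set B in Bs | sg i.+1 * #|p B j :\: Sat j| < W].
have badj (j : 'I_t) : i < j -> 4 * t * #|Bad j| <= g.
  move=> ij; have jj : i < j < t by rewrite ij ltn_ord.
  have jj' : i <= j < t by rewrite ltnW //= ltn_ord.
  (* A block of [Bad j] loses at least [W / sg i.+1] points of part [j], because [sg] doubles from
     one level to the next. *)
  have h1 : W * #|Bad j| <= sg i.+1 * (#|Sat j| * Dl i).
    have : W * #|Bad j| <= sg i.+1 * \sum_(B in Bad j) #|p B j :&: Sat j|.
      rewrite mulnC -sum_nat_const big_distrr /=; apply: leq_sum => B.
      rewrite inE => /andP[BBs small]; have := szp B j BBs jj'.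
      have := cardsID (Sat j) (p B j).
      have -> : sg i.+1 = 2 * sg i by rewrite /sg expnS; ring.
      move: small; have -> : sg i.+1 = 2 * sg i by rewrite /sg expnS; ring.
      by move=> h <-; lia.
    move=> /leq_trans; apply; rewrite leq_mul2l; apply/orP; right.
    apply: (@leq_trans (\sum_(B in Bs) #|p B j :&: Sat j|)).
      rewrite [X in _ <= X](bigID (mem (Bad j))) /=.
      rewrite (leq_trans _ (leq_addr _ _)) //; apply/eq_leq/eq_bigl => B.
      by rewrite !inE; case: (B \in Bs).
    rewrite -sum_deg -sum_nat_const; apply: leq_sum => u _; exact: degp.
  (* Every saturated point takes at least [Dl i.+1] of the total degree of [Bs'], which is at most
     [tau * Dl i * W]. *)
  have h2 : #|Sat j| * Dl i.+1 <= tau * Dl i * W.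
    apply: (@leq_trans (\sum_u deg Bs' p' j u)).
      rewrite -sum_nat_const [X in _ <= X](bigID (mem (Sat j))) /=.
      rewrite (leq_trans _ (leq_addr _ _)) //; apply: leq_sum => u.
      by rewrite inE.
    rewrite sum_degT (leq_trans (_ : _ <= \sum_(B in Bs') W)) //.
      apply: leq_sum => B BB'; have BBs := subsetP sBB _ BB'.
      apply: leq_trans (p0W (subsetP BsB0 _ BBs) (ltn_ord j)).
      by apply: subset_leq_card; apply: subset_trans (sp' _ _ BB' jj) (pp0 _ _ BBs jj').
    rewrite sum_nat_const leq_mul2r; apply/orP; right.
    by apply: leq_trans cB' _; rewrite leq_mul2r kt orbT.
  have h3 : #|Bad j| * Dl i.+1 <= sg i.+1 * tau * Dl i ^ 2.
    rewrite -(leq_pmul2l W0).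
    have -> : W * (#|Bad j| * Dl i.+1) = W * #|Bad j| * Dl i.+1 by ring.
    apply: leq_trans (leq_mul h1 (leqnn _)) _.
    have -> : sg i.+1 * (#|Sat j| * Dl i) * Dl i.+1 =
      sg i.+1 * Dl i * (#|Sat j| * Dl i.+1) by ring.
    apply: leq_trans (leq_mul (leqnn _) h2) _.
    by apply/eq_leq; ring.
  have h4 : #|Bad j| * (8 * t * G i) <= sg i.+1 * q * Dl i.
    rewrite -(leq_pmul2r d0).
    have -> : #|Bad j| * (8 * t * G i) * Dl i = #|Bad j| * (8 * t * G i * Dl i) by ring.
    rewrite -DlS // mulnA.
    apply: leq_trans (leq_mul h3 (leqnn _)) _.
    by apply/eq_leq; rewrite qE; ring.
  have h5 : sg i.+1 = 2 * sg i by rewrite /sg expnS; ring.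
  rewrite -(leq_pmul2l G0) -(@leq_pmul2l 2) //.
  have -> : 2 * (G i * (4 * t * #|Bad j|)) = #|Bad j| * (8 * t * G i) by ring.
  apply: (leq_trans h4); rewrite h5.
  have -> : 2 * sg i * q * Dl i = 2 * (sg i * q * Dl i) by ring.
  by rewrite leq_mul2l gG orbT.
have t0 : 0 < t by apply: leq_trans it.
have bad : 4 * \sum_(j < t | i < j) #|Bad j| <= g.
  rewrite -(leq_pmul2l t0) mulnCA mulnA big_distrr /=.
  apply: leq_trans (_ : \sum_(j < t | i < j) g <= _).
    by apply: leq_sum => j; apply: badj.
  rewrite sum_nat_const leq_mul2r; apply/orP; right.
  by rewrite -[X in _ <= X]card_ord max_card.
have : Bs \subset Good :|: Bs' :|: \bigcup_(j < t | i < j) Bad j.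
  apply/subsetP => B BBs; rewrite !inE BBs andbT.
  case: (B \in Bs') => //=; rewrite ?orbT ?orbF //; case: (boolP [forall j, _]) => //= /forallPn[j].
  rewrite negb_imply -ltnNge => /andP[ij small]; apply/bigcupP; exists j => //.
  by rewrite inE BBs.
move=> /subset_leq_card; rewrite -/g.
have := leq_card_setU (Good :|: Bs') (\bigcup_(j < t | i < j) Bad j).
have := leq_card_setU Good Bs'.
have : #|\bigcup_(j < t | i < j) Bad j| <= \sum_(j < t | i < j) #|Bad j|.
  elim/big_rec2: _ => [|j s1 s2 _ IH]; first by rewrite cards0.
  by apply: leq_trans (leq_card_setU _ _).1 _; rewrite leq_add2l.
case=> [h1 [h2 _] [h3 _]]; lia.
Qed.

(** Count incidences in part [i] of the good blocks: points outside [H] contribute at most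
    [x * Dl i / (4 * G i)] altogether, half of what [card_good] guarantees, and each point of [H] at
    most [Dl i]. *)
Lemma card_heavy : x <= 4 * G i * #|H|.
Proof.
have [BsB0 szp pp0 degp big] := Hl; have [sBB cB' _ [_ sp' degp']] := Hr.
have i_t : i < t by apply: ltnW.
have cg := card_good; have d0 := Dl0 i_t.
have GB : Good \subset Bs by apply/subsetP => B; rewrite !inE => /andP[/andP[]].
have s0 : 0 < sg i by rewrite muln_gt0 C2_gt0 expn_gt0.
have ii : i <= i < t by rewrite leqnn.
have h1 : #|Good| * W <= sg i * \sum_(B in Good) #|p B i|.
  rewrite big_distrr /= -sum_nat_const; apply: leq_sum => B BG.
  by apply: szp; rewrite ?(subsetP GB).
have h2 : 4 * G i * \sum_(B in Good) #|p B i| <= 4 * G i * #|H| * Dl i + x * Dl i.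
  rewrite -sum_degT (bigID (mem H)) /= mulnDr leq_add //.
    rewrite -[X in _ <= X]mulnA leq_mul2l; apply/orP; right.
    rewrite -sum_nat_const; apply: leq_sum => u _.
    apply: leq_trans (degp i u ii); apply: subset_leq_card.
    by apply/subsetP => B; rewrite !inE => /andP[/andP[/andP[_ ->]]].
  rewrite big_distrr /= (bigID (mem X)) /= [X in _ + X]big1 ?addn0.
    apply: leq_trans (_ : \sum_(u in X) Dl i <= _); last by rewrite sum_nat_const.
    rewrite [X in _ <= X](bigID (mem H)) /= addnC (leq_trans _ (leq_addr _ _)) //.
    rewrite [X in _ <= X](eq_bigl (fun u => (u \notin H) && (u \in X))); last first.
      by move=> u; rewrite andbC.
    by apply: leq_sum => u /andP[uH uX]; move: uH; rewrite inE uX /= -ltnNge => /ltnW.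
  move=> u /andP[_ uX]; apply/eqP; rewrite muln_eq0; apply/orP; right.
  rewrite /deg cards_eq0; apply/eqP/setP => B; rewrite inE in_set0.
  apply/negP => /andP[BG up]; case/negP: uX.
  have BBs := subsetP GB _ BG.
  by apply: (subsetP (p0X (subsetP BsB0 _ BBs) i_t)); apply: (subsetP (pp0 _ _ BBs ii)).
rewrite -(leq_pmul2r d0) -(leq_pmul2r s0).
move: (leq_mul (leqnn (4 * G i)) h1) (leq_mul (leqnn (sg i)) h2).
move: (leq_mul (leqnn (2 * G i)) (leq_mul cg (leqnn W))) big.
move: (#|H|) (#|Good|) (#|Bs|) (\sum_(B in _) _) => h gd b sm.
set s := sg i; set D := Dl i; set g := G i; clear; nia.
Qed.

Variable v : T.
Hypothesis vH : v \in H.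
Let N := [set B in Good | v \in p B i].
Let p'' B j := if B \in Bs' then p' B j else p B j :\: Sat j.

(** Good blocks keep large parts after the removal of [Sat], membership of [v] in [H] gives the
    lower bound on the number of new blocks, and by linearity a point gains degree at most one. *)
Lemma pick_round : round_inv i k.+1 Bs p (Bs' :|: N) p''.
Proof.
have [BsB0 szp pp0 degp big] := Hl; have [sBB cB' cB'' [szp' sp' degp']] := Hr.
have i_t : i < t by apply: ltnW.
have ii : i <= i < t by rewrite leqnn.
have NB : N \subset Bs :\: Bs'.
  by apply/subsetP => B; rewrite !inE => /andP[/andP[]].
have NBs : N \subset Bs by apply: subset_trans NB (subsetDl _ _).
have NI : Bs' :&: N = set0.
  apply/setP => B; rewrite in_set0; apply/negP; rewrite inE => /andP[BB' BN].
  by have := subsetP NB _ BN; rewrite inE BB'.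
have cN : #|Bs' :|: N| = #|Bs'| + #|N| by rewrite cardsU NI cards0 subn0.
have nN : #|N| = deg Good p i v by [].
split.
- by rewrite subUset sBB.
- rewrite cN mulSn addnC leq_add //; apply: leq_trans (degp i v ii).
  apply: subset_leq_card; apply/subsetP => B BN; rewrite inE (subsetP NBs) //=.
  by move: BN; rewrite inE => /andP[].
- rewrite cN mulSn mulnDr addnC leq_add // nN.
  by move: vH; rewrite inE => /andP[].
split.
- move=> B j; rewrite /p'' inE; case: ifP => [BB' _|_ /=]; first exact: szp'.
  rewrite !inE => /andP[/andP[_ /forallP h] _] /andP[ij jt].
  by have := h (Ordinal jt); rewrite /= ij.
- move=> B j; rewrite /p'' inE; case: ifP => [BB' _|_ /=]; first exact: sp'.
  by move=> _ _; rewrite subsetDl.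
move=> j u jj; have /andP[ij jt] := jj.
have jj' : i <= j < t by rewrite ltnW.
have -> : deg (Bs' :|: N) p'' j u =
    deg Bs' p' j u + #|[set B in N | u \in p B j :\: Sat j]|.
  rewrite /deg -cardsUI [X in _ + X](_ : _ = 0) ?addn0; last first.
    apply/eqP; rewrite cards_eq0 -subset0 -NI; apply/subsetP => B.
    by rewrite in_setI !inE => /andP[/andP[-> _] /andP[-> _]].
  apply: eq_card => B; rewrite in_setU ![in LHS]inE ![in RHS]inE /p''.
  case: (boolP (B \in Bs')) => [BB'|BB'] /=; last by rewrite !inE.
  by rewrite orbF.
have [uS|uS] := boolP (u \in Sat j).
  rewrite [X in _ + X](_ : _ = 0) ?addn0; first exact: degp'.
  by apply: eq_card0 => B; rewrite inE in_setD uS andbF.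
move: (uS); rewrite inE -ltnNge => du.
apply: leq_trans du; rewrite -addn1 leq_add2l.
apply/card_le1_eqP => B B'; rewrite !inE.
move=> /andP[/andP[/andP[/andP[_ BBs] _] vB] /andP[_ uB]].
move=> /andP[/andP[/andP[/andP[_ BBs'] _] vB'] /andP[_ uB']].
have B0B := subsetP BsB0 _ BBs; have B0B' := subsetP BsB0 _ BBs'.
have uBj := subsetP (pp0 _ _ BBs jj') _ uB.
have vBi := subsetP (pp0 _ _ BBs ii) _ vB.
have uBj' := subsetP (pp0 _ _ BBs' jj') _ uB'.
have vBi' := subsetP (pp0 _ _ BBs' ii) _ vB'.
(* The point [v] lies in part [i] of [B], so disjointness of the parts excludes [u = v]. *)
have [uv|uv] := eqVneq u v; last by apply: esym (lin uv B0B B0B' jt jt i_t i_t uBj vBi uBj' vBi').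
rewrite uv in uBj; have := dis B0B jt i_t uBj vBi.
by move=> ji; rewrite ji ltnn in ij.
Qed.

End Pick.

(** Induction on the levels left, with an inner induction on the choices left in a round. Each of
    the [tau] choices of a round branches into at most [1 + #|T|] cases: avoid [H], or contain a
    given point of it. The last level needs no choice. *)
Lemma level_covered n i Bs p : i + n.+1 = t -> level_inv i Bs p ->
  covered (level_fam i Bs) ((1 + #|T|) ^ (n * tau)) shrunk.
Proof.
elim: n i Bs p => [|n IH] i Bs p it Hl.
  by apply: level_last Hl; rewrite -it addn1.
have i1t : i.+1 < t by lia.
have i_t := ltnW i1t.
have [BsB0 szp pp0 degp big] := Hl.
pose A := (1 + #|T|) ^ (n * tau).
suff round k m Bs' p' : m + k = tau -> round_inv i m Bs p Bs' p' ->
    covered (round_fam i Bs Bs') ((1 + #|T|) ^ k * A) shrunk.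
  apply: covered_imply (round tau 0 set0 (fun _ _ => set0) _ _) => //.
  - by move=> S fS; split=> // B; rewrite inE.
  - by rewrite /A -expnD.
  split; rewrite ?sub0set ?cards0 //; split=> [B j|B j|j u _]; rewrite ?inE //.
  by rewrite /deg (eq_card0 (fun B => _)) // => B; rewrite !inE.
elim: k m Bs' p' => [|k IHk] m Bs' p' mk Hr.
  have [sBB cB' cB'' [szp' sp' degp']] := Hr.
  apply: covered_imply (IH i.+1 Bs' p' _ _).
  - move=> S [[indS hit] hit']; split=> // B j BB'; rewrite ltnS leq_eqVlt.
    by case/orP => [/eqP ->|ji]; [apply: hit'|apply: hit ji; apply: (subsetP sBB)].
  - by rewrite expn0 mul1n.
  - by rewrite addSnnS.
  split=> //; first exact: subset_trans BsB0.
    move=> B j BB' jj; apply: subset_trans (sp' _ _ BB' jj) _.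
    by apply: pp0; [apply: (subsetP sBB)|case/andP: jj => /ltnW -> ->].
  have d0 := Dl0 i_t; have := DlS i1t; have := GS i1t; move: cB'' xW.
  rewrite addn0 in mk; rewrite mk qE (_ : sg i.+1 = 2 * sg i); last first.
    by rewrite /sg expnS; ring.
  have [/eqP|G0] := posnP (G i).
    move/eqP => ->; rewrite !muln0 !mul0n leqn0 muln_eq0 => /orP[/eqP -> |]; last by lia.
    rewrite !mul0n !muln0 leqn0 => /eqP -> *.
    by rewrite muln0.
  have L0 : 0 < Lam by apply: leq_trans (GLam i_t); rewrite muln_gt0.
  move=> h1 h2 h3 h4.
  (* The density condition of the next level: bound [x] by [xW], express [tau * Dl i] through
     [#|Bs'|], and absorb the constants in [G i.+1]. *)
  rewrite -(leq_pmul2r L0).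
  have -> : Dl i.+1 * x * (2 * sg i) * Lam = Dl i.+1 * Lam * x * (2 * sg i) by ring.
  rewrite h4.
  apply: leq_trans (_ : 8 * t * G i * Dl i * (C1 * W * (tau * Lam)) * (2 * sg i) <= _).
    by rewrite leq_mul2r leq_mul2l h2 !orbT.
  have -> : 8 * t * G i * Dl i * (C1 * W * (tau * Lam)) * (2 * sg i) =
    16 * t * G i * C1 * W * Lam * sg i * (tau * Dl i) by ring.
  apply: leq_trans (leq_mul (leqnn _) h1) _.
  have -> : 16 * t * G i * C1 * W * Lam * sg i * (4 * G i * #|Bs'|) =
    64 * t * sg i * G i ^ 2 * C1 * (#|Bs'| * W * Lam) by ring.
  apply: leq_trans (leq_mul h3 (leqnn _)) _.
  by apply/eq_leq; ring.
have mt : m <= tau by rewrite -mk leq_addr.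
pose Sat j := [set u | Dl i.+1 <= deg Bs' p' j u].
pose Good := [set B in Bs :\: Bs' |
  [forall j : 'I_t, (i < j) ==> (W <= sg i.+1 * #|p B j :\: Sat j|)]].
pose H := [set v in X | Dl i <= 4 * G i * deg Good p i v].
have Ax : 0 < (1 + #|T|) ^ k * A by rewrite muln_gt0 /A !expn_gt0.
apply: covered_imply (fun S fS => fS) _ (covered_branch (H := H) (C := X :\: H)
   (n := (1 + #|T|) ^ k * A) _ _ _).
- by rewrite expnS -mulnA mulnDl mul1n leq_add2r.
- apply: (@shrunk_compl _ (G i)); last exact: card_heavy Hl Hr.
    by apply/subsetP => v; rewrite inE => /andP[].
  exact: GM.
- by move=> S [[[SX _] _] _] SH; rewrite subsetD SX.
move=> v vH; apply: covered_imply (IHk m.+1 _ _ _ (pick_round i1t Hl Hr vH)) => //.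
  move=> S [[fS hS] vS]; split=> // B; rewrite inE => /orP[|]; first exact: hS.
  rewrite !inE => /andP[/andP[/andP[_ BBs] _] vB]; apply/existsP; exists v.
  by rewrite vS (subsetP (pp0 _ _ BBs _)) // leqnn.
by rewrite addSnnS.
Qed.

Lemma container_step : 0 < t -> (forall B j, B \in B0 -> j < t -> W <= C2 * #|p0 B j|) ->
    (forall j u, j < t -> deg B0 p0 j u <= Dl 0) ->
    Dl 0 * x * C2 <= G 0 * #|B0| * W ->
  covered indep ((1 + #|T|) ^ (t.-1 * tau)) shrunk.
Proof.
move=> t0 sz0 deg0 big0.
apply: covered_imply (@level_covered t.-1 0 B0 p0 _ _) => //; last first.
  by split=> //; rewrite /sg ?expn0 ?muln1.
by rewrite prednK.
Qed.

End Container.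

(** * Labelling the lines of the plane *)

Section Chunks.
Variables (K : finFieldType) (D : {set K}).
Implicit Types (X Z : {set K * K}) (c : K * {set K * K}).

Definition on_line a Z := [forall P in Z, forall Q in Z, icpt a P == icpt a Q].

(** In a maximal family at most [W] points stay uncovered on each of the [#|K|] lines of slope [a],
    hence at most half of [X] in all. *)
Lemma max_chunks X W a : 0 < W -> 2 * #|K| * W <= #|X| ->
  exists Ps : {set {set K * K}}, [/\ forall Z, Z \in Ps -> [&& Z \subset X, #|Z| == W & on_line a Z],
    trivIset Ps & #|X| <= 2 * W * #|Ps|].
Proof.
move=> W0 WX.
pose ok (Ps : {set {set K * K}}) := [forall Z in Ps, [&& Z \subset X, #|Z| == W & on_line a Z]] && trivIset Ps.
have [|Ps maxPs] := @ex_maxset _ ok.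
  by exists set0; apply/andP; split; [apply/forall_inP => Z|apply/trivIsetP => Z Z']; rewrite inE.
have [/andP[/forall_inP Pok triv] maxl] := maxsetP maxPs.
exists Ps; split=> //.
pose R b : {set K * K} := [set P in X :\: cover Ps | icpt a P == b].
have Rsmall b : #|R b| <= W.
  rewrite leqNgt; apply/negP => /ltnW /subset_of_card[Z ZR cZ].
  have Zdis B : B \in Ps -> [disjoint Z & B].
    move=> BP; rewrite disjoint_subset; apply/subsetP => P /(subsetP ZR).
    rewrite !inE => /andP[/andP[PC _] _]; apply: contra PC => PB.
    by apply/bigcupP; exists B.
  have Ps0 : set0 \notin Ps.
    by apply/negP => /Pok /and3P[_]; rewrite cards0 => /eqP; case: (W) W0.
  have [triv' /negP ZP] := trivIsetU1 Zdis triv Ps0.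
  apply: ZP; rewrite -(maxl (Z |: Ps)) ?setU11 ?subsetUr // /ok triv' andbT.
  apply/forall_inP => B /setU1P[->|/Pok //]; apply/and3P; split.
  - by apply/subsetP => P /(subsetP ZR); rewrite !inE => /andP[/andP[]].
  - by rewrite cZ.
  apply/forall_inP => P /(subsetP ZR); rewrite inE => /andP[_ /eqP ->].
  by apply/forall_inP => Q /(subsetP ZR); rewrite inE => /andP[_ /eqP ->].
have cX : #|X| <= #|Ps| * W + #|K| * W.
  rewrite -(cardsID (cover Ps) X) leq_add //.
    apply: leq_trans (subset_leq_card (subsetIr _ _)) _.
    rewrite -(eqP triv) -sum_nat_const leq_eqVlt; apply/orP; left; apply/eqP.
    by apply: eq_bigr => Z /Pok /and3P[_ /eqP].
  rewrite -sum1_card (partition_big (icpt a) predT) //= -sum_nat_const.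
  apply: leq_sum => b _; apply: leq_trans (Rsmall b).
  by rewrite -sum1_card; apply/eq_leq/eq_bigl => P; rewrite !inE.
by lia.
Qed.

Definition chunk_system X W (Cs : {set K * {set K * K}}) :=
  (forall c, c \in Cs -> [/\ c.1 \in D, c.2 \subset X, #|c.2| = W & on_line c.1 c.2]) /\
  (forall c c', c \in Cs -> c' \in Cs -> c.1 = c'.1 -> c != c' -> [disjoint c.2 & c'.2]).

Lemma exists_chunks X W : 0 < W -> 2 * #|K| * W <= #|X| ->
  exists2 Cs, chunk_system X W Cs & #|D| * #|X| <= 2 * W * #|Cs|.
Proof.
move=> W0 WX.
have [Ps PsP] := fin_all_exists (fun a => @max_chunks X W a W0 WX).
exists [set c | (c.1 \in D) && (c.2 \in Ps c.1)].
  split=> [[a Z]|[a Z] [a' Z']]; rewrite !inE /=.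
    by move=> /andP[aD]; have [h _ _] := PsP a => /h /and3P[? /eqP ? ?].
  move=> /andP[_ ZP] /andP[_ ZP'] aa; rewrite -aa in ZP' *.
  rewrite xpair_eqE eqxx /= => ZZ; have [_ /trivIsetP tr _] := PsP a.
  exact: tr.
rewrite -[#|[set _ | _]|]sum1_card.
rewrite (eq_bigl (fun c => (c.1 \in D) && (c.2 \in Ps c.1))); last by move=> c; rewrite inE.
rewrite -(pair_big_dep (mem D) (fun a Z => Z \in Ps a) (fun _ _ => 1)) /=.
rewrite big_distrr /= -sum_nat_const; apply: leq_sum => a _.
by rewrite sum1_card; have [_ _] := PsP a.
Qed.

Variables (t C : nat).
Implicit Types lab : {ffun K * (K * K) -> 'I_t}.

(** A label belongs to a pair of a slope and a point, so the labels of one point on different lines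
    are independent. *)
Definition label_class lab c (j : 'I_t) := [set P in c.2 | lab (c.1, P) == j].

Definition good_chunk W lab c := [forall j, W <= C * #|label_class lab c j|].

Hypothesis hC : 32 * (2 * t).-1 ^ C <= (2 * t) ^ C.

(** Fix which chunks fail and their rare labels: by [few_matches] at most a proportion
    [4 ^ -(w * #|Cs|)] of the labellings agrees with this, and there are at most
    [(t + 1) ^ #|Cs| <= 2 ^ (w * #|Cs|)] such choices. *)
Lemma few_bad_labels X w (Cs : {set K * {set K * K}}) :
    chunk_system X (C * w) Cs -> t < 2 ^ w ->
  #|[set lab | 2 * #|[set c in Cs | good_chunk (C * w) lab c]| < #|Cs|]| * 2 ^ (w * #|Cs|)
    <= t ^ #|{: K * (K * K)}|.
Proof.
move=> [Cok Cdis] tw; set M := #|Cs|; set Bad := [set lab | _]; set N := t ^ _.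
(* Union bound over certificates [h]: they name a rare label for at least half of the chunks. *)
pose J (h : {ffun K * {set K * K} -> option 'I_t}) := [set c in Cs | h c].
pose flags c : {set K * (K * K)} := [set u | (u.1 == c.1) && (u.2 \in c.2)].
(* Distinct chunks have disjoint sets of flags, so each flag is aimed at the rare label of at most
   one chunk. *)
pose tgt h (u : K * (K * K)) :=
  if [pick c in J h | u \in flags c] is Some c then h c else None.
have flags_dis c c' : c \in Cs -> c' \in Cs -> c != c' -> [disjoint flags c & flags c'].
  move=> cC c'C cc; rewrite disjoint_subset; apply/subsetP => u; rewrite !inE.
  move=> /andP[/eqP u1 u2]; apply/negP => /andP[/eqP u1' u2'].
  have := Cdis _ _ cC c'C; rewrite -u1 -u1' => /(_ erefl cc).
  by move=> /disjoint_setI0 /setP /(_ u.2); rewrite !inE u2 u2'.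
have JC h c : c \in J h -> c \in Cs by rewrite inE => /andP[].
have tgtE h c u : c \in J h -> u \in flags c -> tgt h u = h c.
  move=> cJ uc; rewrite /tgt; case: pickP => [c' /andP[c'J uc']|/(_ c)]; last by rewrite cJ uc.
  have [-> //|cc] := eqVneq c' c.
  have := flags_dis _ _ (JC _ _ c'J) (JC _ _ cJ) cc.
  by move=> /disjoint_setI0 /setP /(_ u); rewrite in_setI uc uc' inE.
have cflags c : #|flags c| = #|c.2|.
  have -> : flags c = [set (c.1, P) | P in c.2].
    apply/setP => -[x P]; rewrite inE /=; apply/andP/imsetP => [[/eqP -> Pc]|[Q Qc [-> ->]]].
      by exists P.
    by rewrite eqxx.
  by rewrite card_imset // => P Q [].
pose E h := [set lab : {ffun K * (K * K) -> 'I_t} |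
  #|[set u | tgt h u == Some (lab u)]| <= w * #|J h|].
pose Hs := [set h | (h \in pffun_on None (mem Cs) predT) && (M <= 2 * #|J h|)].
have cE h : h \in Hs -> #|E h| * 4 ^ (w * M) <= N.
  rewrite inE => /andP[_ hM]; apply: leq_trans (few_matches (tgt := tgt h) hC (n := w * #|J h|) _).
    rewrite leq_mul2l -[16]/(4 ^ 2) -expnM leq_pexp2l ?orbT //.
    by rewrite mulnCA leq_mul2l hM orbT.
  have -> : C * (w * #|J h|) = #|\bigcup_(c in J h) flags c|.
    rewrite card_bigcup_disjoint => [|c c' cJ c'J]; last first.
      by apply: flags_dis; [apply: JC cJ|apply: JC c'J].
    rewrite mulnA mulnC -sum_nat_const; apply: eq_bigr => c /JC cC; rewrite cflags.
    by have [_ _ ->] := Cok c cC.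
  apply: subset_leq_card; apply/subsetP => u /bigcupP[c cJ uc].
  by rewrite inE (tgtE _ _ _ cJ uc); move: cJ; rewrite inE => /andP[].
have cov : Bad \subset \bigcup_(h in Hs) E h.
  apply/subsetP => lab; rewrite inE => few.
  pose h : {ffun K * {set K * K} -> option 'I_t} := [ffun c =>
    if c \in Cs then [pick j | C * #|label_class lab c j| < C * w] else None].
  have hP c : c \in J h -> exists2 j, h c = Some j & #|label_class lab c j| < w.
    rewrite inE ffunE => /andP[-> ]; case: pickP => // j; rewrite ltn_mul2l => /andP[_ jw] _.
    by exists j.
  have split : Cs = [set c in Cs | good_chunk (C * w) lab c] :|: J h.
    apply/setP => c; rewrite !inE ffunE; case: (c \in Cs) => //=.
    case: pickP => [j _|none]; first by rewrite orbT.
    by rewrite orbF; symmetry; apply/forallP => j; rewrite leqNgt none.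
  have hM : M <= 2 * #|J h|.
    have : M <= #|[set c in Cs | good_chunk (C * w) lab c]| + #|J h|.
      by rewrite /M {1}split; apply: (leq_card_setU _ _).1.
    by move: few; rewrite -/M; lia.
  apply/bigcupP; exists h.
    rewrite inE hM andbT; apply/pffun_onP; split=> //.
    by apply/subsetP => c; rewrite !inE ffunE; case: ifP.
  rewrite inE.
  have sub : [set u | tgt h u == Some (lab u)] \subset
      \bigcup_(c in J h) [set u in flags c | h c == Some (lab u)].
    apply/subsetP => u; rewrite inE {1}/tgt; case: pickP => // c /andP[cJ uc] hc.
    by apply/bigcupP; exists c; rewrite // inE uc.
  apply: leq_trans (subset_leq_card sub) _; apply: leq_trans (card_bigcup_le _ _) _.
  rewrite mulnC -sum_nat_const; apply: leq_sum => c cJ; have [j hj jw] := hP c cJ.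
  apply: leq_trans (ltnW jw).
  rewrite -(card_imset (mem (label_class lab c j)) (f := pair c.1)); last by move=> P Q [].
  apply: subset_leq_card; apply/subsetP => -[x P]; rewrite !inE /= hj.
  move=> /andP[/andP[/eqP -> Pc] /eqP [jE]]; apply/imsetP; exists P => //.
  by rewrite inE Pc -jE eqxx.
have cHs : #|Hs| <= 2 ^ (w * M).
  apply: leq_trans (_ : #|pffun_on (None : option 'I_t) (mem Cs) predT| <= _).
    by apply: subset_leq_card; apply/subsetP => h; rewrite inE => /andP[].
  rewrite card_pffun_on expnM; apply: leq_exp2rW.
  by rewrite -[#|predT|]/(#|{: option 'I_t}|) card_option card_ord.
rewrite -(@leq_pmul2r (2 ^ (w * M))) ?expn_gt0 //.
have -> : #|Bad| * 2 ^ (w * M) * 2 ^ (w * M) = #|Bad| * 4 ^ (w * M).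
  by rewrite -mulnA -expnMn.
apply: leq_trans (_ : \sum_(h in Hs) #|E h| * 4 ^ (w * M) <= _).
  rewrite -big_distrl /= leq_mul2r; apply/orP; right.
  exact: leq_trans (subset_leq_card cov) (card_bigcup_le _ _).
apply: leq_trans (_ : \sum_(h in Hs) N <= _); first exact: leq_sum.
by rewrite sum_nat_const mulnC leq_mul2l cHs orbT.
Qed.

End Chunks.

(** * A labelling that suits all large sets of points *)

Section Labelling.
Variables (K : finFieldType) (D : {set K}) (t C : nat).
Let q := #|K|.
Let N := #|{: K * K}|.
Hypotheses (t0 : 0 < t) (hC : 32 * (2 * t).-1 ^ C <= (2 * t) ^ C).
Implicit Types (X S : {set K * K}) (lab : {ffun K * (K * K) -> 'I_t}).

Definition balanced lab X w Cs := [/\ 0 < w, chunk_system D X (C * w) Cs,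
  C * w * q <= #|X| <= 4 * (C * w) * q &
  #|D| * #|X| <= 4 * (C * w) * #|[set c in Cs | good_chunk C (C * w) lab c]|].

(** Union bound over all [X]. The number of chunks makes [w X * #|Cs X|] at least
    [#|D| * #|X| / (2 * C)], and [hD] turns this into a failure probability of at most
    [(4 * N) ^ -#|X|]. *)
Lemma exists_labelling x0 : 2 * q * C * t.+1 <= x0 -> (4 * N) ^ (2 * C) <= 2 ^ #|D| ->
  exists lab, forall X, x0 <= #|X| -> exists w Cs, balanced lab X w Cs.
Proof.
move=> hx0 hD.
have C0 : 0 < C by rewrite lt0n; apply: contraTneq hC => ->; rewrite !expn0.
have q0 : 0 < q by apply/card_gt0P; exists 0%R.
pose w X := #|X| %/ (2 * q * C).
have m0 : 0 < 2 * q * C by rewrite !muln_gt0 q0 C0.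
have wt X : x0 <= #|X| -> t < w X.
  by move=> hX; rewrite /w leq_divRL // mulnC (leq_trans hx0).
have wX X : 2 * q * (C * w X) <= #|X|.
  by rewrite mulnA mulnC; apply: leq_trunc_div.
have exCs X : exists Cs, x0 <= #|X| ->
    chunk_system D X (C * w X) Cs /\ #|D| * #|X| <= 2 * (C * w X) * #|Cs|.
  case: (leqP x0 #|X|) => [hX|]; last by exists set0.
  have W0 : 0 < C * w X by rewrite muln_gt0 C0 (leq_trans _ (wt X hX)).
  by have [Cs h1 h2] := exists_chunks D W0 (wX X); exists Cs.
have [Cs CsP] := fin_all_exists exCs.
pose Bad X : {set {ffun K * (K * K) -> 'I_t}} := if x0 <= #|X| then [set lab |
  2 * #|[set c in Cs X | good_chunk C (C * w X) lab c]| < #|Cs X|] else set0.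
have [|X X0|lab labP] := @union_bound _ _ Bad.
- by rewrite card_ffun card_ord expn_gt0 t0.
- rewrite /Bad; case: (leqP x0 #|X|) => [hX|_]; last by rewrite cards0 mul0n.
  have [sys big] := CsP X hX.
  have tw : t < 2 ^ w X by apply: leq_trans (wt X hX) (ltnW (ltn_expl _ _)).
  rewrite card_ffun card_ord; apply: leq_trans (few_bad_labels hC sys tw).
  rewrite leq_mul2l; apply/orP; right.
  rewrite -(@leq_exp2r _ _ (2 * C)) ?muln_gt0 // -/N.
  rewrite expnAC; apply: leq_trans (leq_exp2rW _ hD) _.
  by rewrite -!expnM leq_pexp2l //; apply: leq_trans big _; apply/eq_leq; ring.
exists lab => X hX; exists (w X), (Cs X); have [sys big] := CsP X hX.
have w0 : 0 < w X by apply: leq_trans (wt X hX).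
split=> //.
  apply/andP; split; first by apply: leq_trans (wX X); lia.
  have := ltn_ceil #|X| m0; rewrite -/(w X) => /ltnW /leq_trans; apply.
  have -> : 4 * (C * w X) * q = (w X + w X) * (2 * q * C) by ring.
  by rewrite leq_mul2r -[in X in _ || X]addn1 leq_add2l w0 orbT.
apply: leq_trans big _.
have /labP : X != set0.
  apply: contraTneq hX => ->; rewrite cards0 -ltnNge (leq_trans _ hx0) //.
  by rewrite muln_gt0 m0.
rewrite /Bad hX inE -leqNgt => h.
have -> : 4 * (C * w X) = 2 * (C * w X) * 2 by ring.
by rewrite -[X in _ <= X]mulnA leq_mul2l h orbT.
Qed.

Definition transversal lab S := [exists a in D, exists b, forall j : 'I_t,
  exists P in S, (icpt a P == b) && (lab (a, P) == j)].

Section PlaneContainer.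
Variables (tau Lam M : nat) (Dl G : nat -> nat).
Hypotheses (Dl0 : forall i, i < t -> 0 < Dl i) (qE : q = tau * Lam).
Hypothesis DlS : forall i, i.+1 < t -> Dl i.+1 * Lam = 8 * t * G i * Dl i.
Hypothesis GS : forall i, i.+1 < t -> 64 * t * (C * 2 ^ i) * G i ^ 2 * 4 <= G i.+1.
Hypothesis GLam : forall i, i < t -> 4 * G i <= Lam.
Hypothesis GM : forall i, i < t -> 4 * G i <= M.
Hypotheses (DlD : Dl 0 = #|D|) (G0 : G 0 = 4 * C).

(** The blocks are the good chunks and the parts their label classes. The system is linear because
    two points determine the slope of their line; degrees are at most [#|D|] because a point lies in
    at most one chunk of each slope. *)
Lemma plane_container_step lab X w Cs : balanced lab X w Cs ->
  covered (fun S => ~~ transversal lab S /\ S \subset X) ((1 + N) ^ (t.-1 * tau))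
    (fun Y => M * #|Y| <= M.-1 * #|X|).
Proof.
move=> [w0 [Cok Cdis] /andP[Wx xW] big].
have C0 : 0 < C by rewrite lt0n; apply: contraTneq hC => ->; rewrite !expn0.
pose p0 (c : K * {set K * K}) (j : nat) := [set P in c.2 | val (lab (c.1, P)) == j].
set B0 := [set c in Cs | _] in big.
have BC c : c \in B0 -> c \in Cs by rewrite inE => /andP[].
have same c c' u : c \in B0 -> c' \in B0 -> c.1 = c'.1 -> u \in c.2 -> u \in c'.2 -> c = c'.
  move=> /BC cC /BC c'C cc uc uc'; apply/eqP; apply: contraT => ne.
  by have /disjoint_setI0/setP/(_ u) := Cdis _ _ cC c'C cc ne; rewrite !inE uc uc'.
apply: covered_imply (@container_step _ _ X p0 t (C * w) q tau Lam 4 C M Dl G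
    _ C0 Dl0 qE Wx xW DlS GS GLam GM B0 _ _ _ _ t0 _ _ _) => //.
- move=> S [nS SX]; split=> // -[a Z] /[dup] ZB /BC /Cok[/= aD ZX cZ /forall_inP lZ].
  have [j nj|none] := pickP (fun j : 'I_t => ~~ hits p0 S (a, Z) j); first by exists j.
  case/negP: nS; have allhit (j : 'I_t) : hits p0 S (a, Z) j by have /negbFE := none j.
  have /existsP[P0 /andP[_ P0Z]] := allhit (Ordinal t0).
  rewrite inE in P0Z; have /andP[/= P0Z' _] := P0Z.
  apply/existsP; exists a; rewrite aD /=; apply/existsP; exists (icpt a P0).
  apply/forallP => j; have /existsP[P /andP[PS]] := allhit j; rewrite inE /= => /andP[PZ lP].
  apply/existsP; exists P; rewrite PS -val_eqE /= lP andbT.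
  by have /forall_inP := lZ P PZ; apply.
- by rewrite muln_gt0 C0.
- move=> u v c c' i i' j j' uv cB c'B _ _ _ _; rewrite !inE.
  move=> /andP[uc _] /andP[vc _] /andP[uc' _] /andP[vc' _].
  apply: (same c c' u) => //.
  have [_ _ _ /forall_inP lc] := Cok c (BC c cB).
  have [_ _ _ /forall_inP lc'] := Cok c' (BC c' c'B).
  apply: (icpt_slope uv); apply/eqP.
    by have /forall_inP := lc u uc; apply.
  by have /forall_inP := lc' u uc'; apply.
- by move=> c u i j _ _ _; rewrite !inE => /andP[_ /eqP <-] /andP[_ /eqP <-].
- move=> c j /BC /Cok[_ _ <- _] _; apply: subset_leq_card.
  by apply/subsetP => P; rewrite inE => /andP[].
- move=> c j /BC /Cok[_ cX _ _] _; apply: subset_trans cX.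
  by apply/subsetP => P; rewrite inE => /andP[].
- move=> c j; rewrite inE => /andP[_ /forallP gc] jt.
  by have := gc (Ordinal jt); congr (_ <= _ * _); apply: eq_card => P; rewrite !inE.
- move=> j u jt; rewrite DlD /deg -(card_in_imset (f := fst)).
    apply: subset_leq_card; apply/subsetP => _ /imsetP[c cB ->].
    by move: cB; rewrite inE => /andP[/BC/Cok[]].
  move=> c c'; rewrite !inE => /andP[cB /andP[uc _]] /andP[c'B /andP[uc' _]] cc.
  by apply: same cc uc uc'; rewrite inE.
rewrite DlD G0; have -> : 4 * C * #|B0| * (C * w) = 4 * (C * w) * #|B0| * C by ring.
by rewrite leq_mul2r big orbT.
Qed.

Lemma plane_containers lab x0 k : 0 < M ->
    (forall X, x0 <= #|X| -> exists w Cs, balanced lab X w Cs) ->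
    M.-1 ^ k * N <= x0 * M ^ k ->
  covered (fun S => ~~ transversal lab S) (((1 + N) ^ (t.-1 * tau)) ^ k) (fun Y => #|Y| <= x0).
Proof.
move=> M0 bal hk.
have := @covered_iter _ (fun S => ~~ transversal lab S) ((1 + N) ^ (t.-1 * tau)) M x0 k setT.
rewrite cardsT -/N expn_gt0 => /(_ isT M0 _ hk) [|cs [sz al cov]].
  by move=> X /ltnW/bal[w [Cs balX]]; apply: plane_container_step balX.
by exists cs; split=> // S nS; apply: cov; rewrite subsetT.
Qed.

End PlaneContainer.
End Labelling.

(** * The random graphs *)

Section PulledBackGraph.
Variables (K : finFieldType) (D : {set K}) (F : sgraph).
Variables (lab : {ffun K * (K * K) -> 'I_#|F|}) (n : nat) (pos : {ffun 'I_n -> K * K}).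

Let vlab a P : F := enum_val (lab (a, P)).

(** The graph is pulled back along [pos], which need not be injective: vertices at the same point
    have equal labels and are not adjacent. *)
Definition plane_adj : rel 'I_n := fun u v => [exists a in D,
  (icpt a (pos u) == icpt a (pos v)) && adj (vlab a (pos u)) (vlab a (pos v))].

Fact plane_adj_sym : symmetric plane_adj.
Proof. by move=> u v; apply: eq_existsb => a; rewrite eq_sym adj_sym. Qed.

Fact plane_adj_irr : irreflexive plane_adj.
Proof. by move=> u; apply/existsP => -[a]; rewrite adj_irr !andbF. Qed.

Definition plane_graph : sgraph := SGraph plane_adj_sym plane_adj_irr.

(** The vertices of a clique sit at distinct, pairwise joined points, so [clique_line] puts all but
    at most one on one line; their labels on it are pairwise adjacent, hence distinct, in [F]. *)
Lemma plane_graph_free r : quad_free D -> 4 <= r ->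
  graph_free (complete_graph (r - 1)) F -> graph_free (complete_graph r) plane_graph.
Proof.
move=> Dfree r4 Ffree [phi phi_inj phi_adj]; apply: Ffree.
pose f (i : 'I_r) := pos (phi i).
have fadj i j : i != j -> plane_adj (phi i) (phi j) := @phi_adj i j.
have f_inj : injective f.
  move=> i j fij; apply/eqP; apply: contraT => /fadj/existsP[a /and3P[_ _]].
  by rewrite -/(f i) -/(f j) fij adj_irr.
pose S := [set f i | i : 'I_r].
have cS : #|S| = r by rewrite card_imset // card_ord.
have Sadj : {in S &, forall P Q, P != Q -> exists2 a, a \in D &
    icpt a P = icpt a Q /\ adj (vlab a P) (vlab a Q)}.
  move=> _ _ /imsetP[i _ ->] /imsetP[j _ ->] fij.
  have /fadj/existsP[a /and3P[aD /eqP h1 h2]] : i != j by apply: contra fij => /eqP ->.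
  by exists a.
have [||a [P0 [aD cL]]] := @clique_line K D S Dfree; first by rewrite cS.
  move=> P Q PS QS /(Sadj _ _ PS QS)[a aD [h _]].
  by apply/existsP; exists a; rewrite aD h eqxx.
set L := [set Q in S | _] in cL; rewrite cS -subn1 in cL.
pose g (i : 'I_(r - 1)) : K * K := enum_val (widen_ord cL i).
have gL i : g i \in L := enum_valP _.
have gadj i j : i != j -> adj (vlab a (g i)) (vlab a (g j)).
  move=> ij; have gij : g i != g j.
    apply: contra ij => /eqP /enum_val_inj /(congr1 val) /= h.
    by apply/eqP/val_inj.
  move: (gL i) (gL j); rewrite !inE => /andP[giS /eqP hi] /andP[gjS /eqP hj].
  have [a' _ [h1 h2]] := Sadj _ _ giS gjS gij.
  (* The adjacency comes with its own slope, which is [a] since both points lie on the line of slope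
     [a]. *)
  suff -> : a = a' by [].
  by apply: (icpt_slope gij) h1; rewrite hi hj.
exists (fun i => vlab a (g i)); last exact: gadj.
move=> i j gij; apply/eqP; apply: contraT => /gadj.
by rewrite gij adj_irr.
Qed.

Lemma plane_graph_contains (S : {set plane_graph}) :
  transversal D lab [set pos v | v in S] -> graph_contains F (induced_graph S).
Proof.
move=> /existsP[a /andP[aD /existsP[b /forallP h]]].
have ex (x : F) : exists v : {v : plane_graph | v \in S},
    (icpt a (pos (val v)) == b) && (lab (a, pos (val v)) == enum_rank x).
  have /existsP[P /andP[/imsetP[v vS ->] hv]] := h (enum_rank x).
  by exists (Sub v vS).
have [phi phiP] := fin_all_exists ex.
have vphi x : vlab a (pos (val (phi x))) = x.
  by have /andP[_ /eqP h2] := phiP x; rewrite /vlab h2 enum_rankK.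
exists phi => [x y xy|x y xy]; first by rewrite -[x]vphi -[y]vphi xy.
have /andP[/eqP hx _] := phiP x; have /andP[/eqP hy _] := phiP y.
by apply/existsP; exists a; rewrite aD hx hy eqxx !vphi.
Qed.

End PulledBackGraph.

(** * Random placement of the vertices *)

Section RandomMap.

Lemma expn_le_fact m : m ^ m <= 4 ^ m * m`!.
Proof.
elim: m => // m IH; rewrite !expnS factS -mulnA.
rewrite [4 ^ m * _]mulnCA mulnCA leq_mul2l /=; apply: leq_trans (expn_succ_le4 m) _.
by rewrite leq_mul2l.
Qed.

Lemma bin_le_expn n m : 'C(n, m) * m ^ m <= 4 ^ m * n ^ m.
Proof.
apply: leq_trans (leq_mul (leqnn _) (expn_le_fact m)) _.
rewrite mulnCA leq_mul2l bin_ffact; apply/orP; right.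
elim: m n => // m IH n; rewrite ffactnS expnS leq_mul2l.
by rewrite (leq_trans (IH _)) ?orbT // leq_exp2rW // leq_pred.
Qed.

(** Union bound over the [m]-sets and the containers: a random map sends a given [m]-set into a
    given container with probability at most [(x0 / #|T|) ^ m]. *)
Lemma exists_map (T : finType) n m x0 A (P : {set T} -> Prop) :
    covered P A (fun Y => #|Y| <= x0) -> 0 < m <= n -> 0 < #|T| ->
    4 ^ m * A * (n * x0) ^ m < (#|T| * m) ^ m ->
  exists pos : {ffun 'I_n -> T}, forall S : {set 'I_n}, #|S| = m -> ~ P [set pos v | v in S].
Proof.
move=> [cs [sz /allP al cov]] /andP[m0 mn] T0 hm.
pose E (S : {set 'I_n}) (Y : {set T}) : {set {ffun 'I_n -> T}} :=
  [set f : {ffun 'I_n -> T} | [forall i in S, f i \in Y]].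
pose Ss := [set S : {set 'I_n} | #|S| == m].
pose Bad := \bigcup_(S in Ss) \bigcup_(Y in [set Y in cs]) E S Y.
have cE S Y : S \in Ss -> Y \in cs -> #|E S Y| <= x0 ^ m * #|T| ^ (n - m).
  rewrite inE => /eqP Sm /al Yx0.
  have -> : #|E S Y| = \prod_(i : 'I_n) (if i \in S then #|Y| else #|T|).
    transitivity #|family (fun i => if i \in S then mem Y else mem T)|.
      apply: eq_card => f; rewrite inE; apply/forall_inP/familyP => h i.
        by case: ifP => // /h.
      by move=> iS; have := h i; rewrite iS.
    rewrite card_family foldrE big_image /=; apply: eq_bigr => i _.
    by case: ifP.
  rewrite prod_if_const card_ord.
  have -> : #|[set i | i \in S]| = m by rewrite -Sm; apply: eq_card => i; rewrite inE.
  by rewrite leq_mul2r leq_exp2rW ?orbT.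
have cBad : #|Bad| <= 'C(n, m) * (A * (x0 ^ m * #|T| ^ (n - m))).
  apply: leq_trans (card_bigcup_le _ _) _.
  apply: leq_trans (_ : \sum_(S in Ss) A * (x0 ^ m * #|T| ^ (n - m)) <= _); last first.
    by rewrite sum_nat_const card_draws card_ord.
  apply: leq_sum => S SS; apply: leq_trans (leq_mul sz (leqnn _)).
  apply: leq_trans (card_bigcup_le _ _) _.
  have le_cs : #|[set Y in cs]| <= size cs by rewrite cardsE card_size.
  apply: leq_trans (leq_mul le_cs (leqnn _)); rewrite -sum_nat_const.
  by apply: leq_sum => Y; rewrite inE; apply: cE.
have small : #|Bad| < #|T| ^ n.
  apply: leq_ltn_trans cBad _.
  rewrite -[X in _ < _ ^ X](subnK mn) expnD [X in _ < X]mulnC 2!mulnA ltn_pmul2r ?expn_gt0 ?T0 //.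
  rewrite -(@ltn_pmul2r (m ^ m)) ?expn_gt0 ?m0 // -expnMn; apply: leq_ltn_trans hm.
  have -> : 'C(n, m) * A * x0 ^ m * m ^ m = A * x0 ^ m * ('C(n, m) * m ^ m) by ring.
  apply: leq_trans (leq_mul (leqnn _) (bin_le_expn n m)) _.
  by rewrite expnMn; apply/eq_leq; ring.
have : Bad != setT.
  by apply: contraTneq small => ->; rewrite cardsT card_ffun card_ord ltnn.
rewrite -properT => /properP[_ [pos _ posB]].
exists pos => S Sm PS; case/negP: posB; have [Y Ycs sub] := cov _ PS.
apply/bigcupP; exists S; first by rewrite inE Sm.
apply/bigcupP; exists Y; rewrite inE //.
by apply/forall_inP => i iS; apply: (subsetP sub); apply: imset_f.
Qed.

End RandomMap.

(** * Choice of parameters *)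

Section Numerics.

Lemma expn_pred_le m : 0 < m -> 2 * m.-1 ^ m <= m ^ m.
Proof.
case: m => // -[|m] _ //=.
have low k : m.+1 ^ k * (m.+1 + k) <= m.+1 * m.+2 ^ k.
  elim: k => [|k IH]; first by rewrite !expn0 addn0 mulnC.
  rewrite !expnSr mulnA; apply: leq_trans (leq_mul IH (leqnn m.+2)).
  by rewrite -!mulnA leq_mul2l; apply/orP; right; nia.
rewrite -(@leq_pmul2l m.+1) // (leq_trans _ (low m.+2)) //.
by rewrite mulnCA mulnA [X in _ <= X]mulnC leq_mul2r; apply/orP; right; lia.
Qed.

Lemma cube_le_exp3 j : j.+1 ^ 3 <= 8 * 3 ^ j.
Proof.
elim: j => // j IH; case: j IH => [|[|j]] IH //; rewrite [3 ^ _]expnS.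
by move: (3 ^ j.+2) IH => x; rewrite !expnS !expn0; nia.
Qed.

Lemma square_lt_exp3 B j : 8 * B < j.+1 -> B * j.+1 ^ 2 < 3 ^ j.
Proof.
move=> Bj; rewrite -(@ltn_pmul2l 8) //; apply: leq_trans (cube_le_exp3 j).
by rewrite mulnA [X in _ < X]expnS ltn_pmul2r // expn_gt0.
Qed.

Variable t : nat.
Hypothesis t0 : 0 < t.

Let C := 10 * t.

(** Since [C = 5 * (2 * t)], five halvings by [expn_pred_le] give the factor [32 = 2 ^ 5]. *)
Lemma label_const : 32 * (2 * t).-1 ^ C <= (2 * t) ^ C.
Proof.
have -> : C = 2 * t * 5 by rewrite /C; ring.
rewrite !(expnM _ (2 * t) 5) -[32]/(2 ^ 5) -expnMn; apply: leq_exp2rW.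
by apply: expn_pred_le; rewrite muln_gt0.
Qed.

(* [gap i] and [mult i * Lam ^ (t - i)] are the parameters [G i] and [Dl i] of the containers. *)
Fixpoint gap i := if i is i'.+1 then 64 * t * (C * 2 ^ i') * gap i' ^ 2 * 4 else 4 * C.

Fixpoint mult i := if i is i'.+1 then 8 * t * gap i' * mult i' else 1.

Lemma gap_gt0 i : 0 < gap i.
Proof.
have C0 : 0 < C by rewrite muln_gt0.
by elim: i => [|i IH] /=; rewrite !muln_gt0 ?expn_gt0 ?IH ?t0 ?C0.
Qed.

Lemma mult_gt0 i : 0 < mult i.
Proof. by elim: i => [|i IH] //=; rewrite !muln_gt0 gap_gt0 IH t0. Qed.

Let M := \max_(i < t) (4 * gap i).

Lemma gap_le_max i : i < t -> 4 * gap i <= M.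
Proof. by move=> it; have := @leq_bigmax _ (fun i : 'I_t => 4 * gap i) (Ordinal it). Qed.

Lemma max_gap_gt0 : 0 < M.
Proof. by apply: leq_trans (gap_le_max t0); rewrite muln_gt0 gap_gt0. Qed.

Variable L : nat.
Hypothesis LE : L = 20 * t + 5.

(* The sum of the coefficients of [(j + 1) ^ 2] in all the lower bounds on [3 ^ j] needed below. *)
Let big := 9 + M + 2 * C * t.+1 + (4 * L + 2) * (2 * C) + (4 * L + 1) * t * (M * (4 * L)).

(** With [q = Q ^ L], [x0 = Q ^ (L + 1)], [n = Q ^ (2 * L - 5)] and [m = Q ^ (L - 3)] the quotient
    [n * x0 / (q ^ 2 * m)] is [1 / Q]. So [exists_map] asks for [4 ^ m * A < Q ^ m], which follows
    from [A < 2 ^ m] and [Q > 8]. *)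
Lemma large_plane_graphs (F : sgraph) r : #|F| = t -> 4 <= r ->
    graph_free (complete_graph (r - 1)) F -> exists j0, forall j, j0 <= j ->
  exists G : sgraph, [/\ #|G| = (3 ^ j) ^ (2 * L - 5), graph_free (complete_graph r) G &
    forall S : {set G}, #|S| = (3 ^ j) ^ (L - 3) -> graph_contains F (induced_graph S)].
Proof.
have L4 : 4 <= L by lia.
have L34 : L - 3 = (L - 4).+1 by lia.
have L35 : L - 3 <= 2 * L - 5 by lia.
have L354 : 2 * L - 5 + L.+1 = 3 * L - 4 by lia.
have L234 : 2 * L + (L - 3) = (3 * L - 4).+1 by lia.
have L0 : 0 < L by lia.
have lowL : (4 * L + 1) * t * (M * (4 * L)) <= big by rewrite /big; lia.
move=> Ft r4 Ffree; exists (8 * big) => j bigj.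
have [Q QE] : exists Q, 3 ^ j = Q by exists (3 ^ j).
have bigQ : big * j.+1 ^ 2 < Q by rewrite -QE; apply: square_lt_exp3.
rewrite QE.
have lowQ c : c <= big -> c * j.+1 ^ 2 < Q.
  by move=> cb; apply: leq_ltn_trans bigQ; rewrite leq_mul2r cb orbT.
have lowQ1 c : c <= big -> c * j.+1 < Q.
  move=> /lowQ; apply: leq_ltn_trans; rewrite leq_mul2l.
  by rewrite -{1}[j.+1]expn1 leq_pexp2l ?orbT.
have lowQ0 c : c <= big -> c < Q.
  by move=> /lowQ1; apply: leq_ltn_trans; rewrite leq_pmulr.
have Q8 : 8 < Q by apply: lowQ0; rewrite /big; lia.
have MQ : M < Q by apply: lowQ0; rewrite /big; lia.
have Q0 : 0 < Q by apply: leq_trans Q8.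
have j0 : 0 < j by move: bigj; rewrite /big; lia.
have [K cK hK] := @pPrimePowerField 3 (j * L) isT (ltac:(by rewrite muln_gt0 j0 L0)).
have qE : #|K| = Q ^ L by rewrite hK expnM QE.
have NE : #|{: K * K}| = Q ^ (2 * L) by rewrite card_prod qE -expnD addnn mul2n.
have two0 : (2%:R != 0 :> K)%R.
  apply/eqP => h2; have := GRing.pcharf0 cK; rewrite -[3]/(2 + 1) GRing.natrD h2 GRing.add0r.
  by move/eqP; rewrite GRing.oner_eq0.
have [D0 D0free D0big] := exists_quad_free two0.
(* With fewer than [Q ^ (4 * t)] slopes in [D0], the bound [5 * #|D0| ^ 5] would be below
   [q = Q ^ (20 * t + 5)]. *)
have [D DD0 cD] : exists2 D : {set K}, D \subset D0 & #|D| = Q ^ (4 * t).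
  apply: subset_of_card; rewrite leqNgt; apply/negP => small.
  have : #|K| < #|K|.
    apply: leq_ltn_trans D0big _; rewrite qE.
    apply: (@leq_ltn_trans (5 * (Q ^ (4 * t)) ^ 5)).
      by rewrite leq_mul2l leq_exp2r // ltnW.
    rewrite -expnM LE (_ : 4 * t * 5 = 20 * t); last by ring.
    rewrite expnD mulnC ltn_pmul2l ?expn_gt0 ?Q0 //.
    apply: leq_trans (_ : Q ^ 1 <= _); first by rewrite expn1; lia.
    by rewrite leq_pexp2l.
  by rewrite ltnn.
have Dfree := quad_freeS DD0 D0free.
have N2 : #|{: K * K}| <= 2 ^ (4 * L * j).
  rewrite NE -QE -expnM; apply: leq_trans (_ : 4 ^ (j * (2 * L)) <= _).
    by apply: leq_exp2rW.
  rewrite -[4]/(2 ^ 2) -expnM leq_pexp2l //; apply/eq_leq; rewrite /=; ring.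
have [||lab bal] := @exists_labelling K D t C t0 label_const (Q ^ L.+1).
- rewrite qE expnS (_ : 2 * Q ^ L * C * t.+1 = 2 * C * t.+1 * Q ^ L); last by ring.
  by rewrite leq_mul2r ltnW ?orbT // lowQ0 // /big; lia.
- rewrite cD; apply: leq_trans (leq_exp2rW (2 * C) (leq_mul (leqnn 4) N2)) _.
  rewrite (_ : 4 * 2 ^ (4 * L * j) = 2 ^ (2 + 4 * L * j)); last by rewrite expnD.
  rewrite -expnM leq_pexp2l //.
  apply: leq_trans (_ : Q ^ 1 <= _); last by rewrite leq_pexp2l // muln_gt0.
  rewrite expn1 ltnW //.
  apply: leq_ltn_trans (lowQ1 ((4 * L + 2) * (2 * C)) _); last by rewrite /big; lia.
  by rewrite [X in _ <= X]mulnAC leq_mul2r mulnDl addnC leq_add ?orbT ?leq_mul ?leq_pmulr.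
(* [Lam ^ t] is [#|D|], so the degree can drop by a factor of order [Lam] from each level to the
   next. *)
pose Lam := Q ^ 4; pose tau := Q ^ (L - 4).
have qtl : #|K| = tau * Lam by rewrite qE /tau /Lam -expnD subnK.
pose Dl i := mult i * Lam ^ (t - i).
have Lam0 : 0 < Lam by rewrite expn_gt0 Q0.
have QLam : Q <= Lam by rewrite -[X in X <= _]expn1 leq_pexp2l.
(* By [expn_pred_le] every [M] steps halve the containers, and the plane has at most
   [2 ^ (4 * L * j)] points. *)
pose k := M * (4 * L * j).
have Dl_gt0 i : i < t -> 0 < Dl i by rewrite muln_gt0 mult_gt0 expn_gt0 Lam0.
have DlS i : i.+1 < t -> Dl i.+1 * Lam = 8 * t * gap i * Dl i.
  move=> it; have -> : Dl i.+1 * Lam = mult i.+1 * Lam ^ (t - i.+1).+1 by rewrite expnSr mulnA.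
  by rewrite subnSK 1?ltnW //= /Dl mulnA.
have gapLam i : i < t -> 4 * gap i <= Lam.
  by move=> /gap_le_max h; apply: leq_trans h (leq_trans (ltnW MQ) QLam).
have Dl0 : Dl 0 = #|D| by rewrite cD /Dl mul1n subn0 -expnM.
have hk : M.-1 ^ k * #|{: K * K}| <= Q ^ L.+1 * M ^ k.
  apply: leq_trans (_ : M ^ k <= _); last by rewrite leq_pmull // expn_gt0 Q0.
  apply: leq_trans (leq_mul (leqnn _) N2) _.
  by rewrite /k !(expnM M) (expnM M.-1) -expnMn mulnC leq_exp2rW // expn_pred_le // max_gap_gt0.
have cov := plane_containers t0 label_const Dl_gt0 qtl DlS (fun i _ => leqnn (gap i.+1))
  gapLam gap_le_max Dl0 erefl max_gap_gt0 bal hk.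
set A := (_ ^ k) in cov.
pose n := Q ^ (2 * L - 5); pose m := Q ^ (L - 3).
have mE : m = tau * Q by rewrite /m L34 expnSr.
(* The exponent of 2 in the bound for [A] is [tau] times a quadratic expression in [j], while [m] is
   [tau * Q]. *)
have A2 : A < 2 ^ m.
  have -> : A = (1 + #|{: K * K}|) ^ (t.-1 * tau * k) by rewrite /A -expnM.
  apply: leq_ltn_trans (leq_exp2rW (n := 2 ^ (4 * L * j + 1)) _ _) _.
    by rewrite addn1 expnS mul2n -addnn leq_add // expn_gt0.
  rewrite -expnM ltn_exp2l // mE.
  rewrite (_ : _ * _ = tau * ((4 * L * j + 1) * t.-1 * k)); last by ring.
  rewrite ltn_pmul2l ?expn_gt0 ?Q0 //.
  apply: leq_ltn_trans (lowQ _ lowL).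
  rewrite (_ : _ * _ ^ 2 = ((4 * L + 1) * j.+1) * t * (M * (4 * L * j.+1))); last by ring.
  by rewrite !leq_mul ?leq_pred // mulnDl mul1n leq_add ?leq_mul.
have [|||pos posP] := @exists_map _ n m _ A _ cov.
- by rewrite expn_gt0 Q0 leq_pexp2l.
- by rewrite NE expn_gt0 Q0.
- rewrite -mulnA NE /n /m -!expnD.
  rewrite L354 L234 [Q ^ _.+1]expnS expnMn mulnA ltn_pmul2r ?expn_gt0 ?Q0 //.
  apply: (@leq_trans (4 ^ m * 2 ^ m)); first by rewrite ltn_pmul2l // expn_gt0.
  by rewrite -expnMn leq_exp2rW // ltnW.
move: lab bal cov pos posP; rewrite -Ft => lab _ _ pos posP.
exists (plane_graph D lab pos); split.
- by rewrite card_ord.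
- exact: plane_graph_free.
move=> S Sm; apply: plane_graph_contains; apply/negbNE/negP.
exact: posP.
Qed.

End Numerics.

(** * Bounds on the extremal function *)

Section Extremal.
Implicit Types F G : sgraph.

Lemma graph_contains_trans F G (H : sgraph) :
  graph_contains F G -> graph_contains G H -> graph_contains F H.
Proof.
move=> [f fi fa] [g gi ga]; exists (g \o f); first exact: inj_comp.
by move=> x y /fa /ga.
Qed.

Lemma induced_contained G (S : {set G}) : graph_contains (induced_graph S) G.
Proof. by exists val => //; apply: val_inj. Qed.

(** The bound passes to smaller orders: restrict [G] to [n] vertices; an [F]-free set there with
    more than [m] vertices would include an [m]-set of [G], and with it a copy of [F]. *)
Lemma max_free_order_le F r n m G : n <= #|G| -> graph_free (complete_graph r) G ->
    (forall S : {set G}, #|S| = m -> graph_contains F (induced_graph S)) ->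
  max_free_order F (complete_graph r) n <= m.
Proof.
move=> nG Gfree Gm; apply/bigmax_leqP => k /boolp.asboolP has_k.
have [V _ cV] : exists2 V : {set G}, V \subset [set: G] & #|V| = n.
  by apply: subset_of_card; rewrite cardsT.
have [||S cS Sfree] := has_k (induced_graph V).
- by rewrite card_sig -cV; apply: eq_card.
- by move=> h; apply: Gfree; apply: graph_contains_trans h (induced_contained V).
rewrite leqNgt; apply/negP => mk; apply: Sfree.
have [T TS cT] : exists2 T : {set G}, T \subset [set val v | v in S] & #|T| = m.
  by apply: subset_of_card; rewrite card_imset ?cS ?(ltnW mk) //; apply: val_inj.
apply: graph_contains_trans (Gm T cT) _.
have ex (x : {x : G | x \in T}) : exists y : {y : induced_graph V | y \in S},
    val (val y) = val x.
  by have /imsetP[y yS ->] := subsetP TS _ (valP x); exists (Sub y yS).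
have [g gP] := fin_all_exists ex.
exists g => [x y xy|x y xy]; first by apply: val_inj; rewrite -!gP xy.
by change (adj (val (val (g x))) (val (val (g y)))); rewrite !gP.
Qed.

Lemma max_free_order_bound F r : 4 <= r -> graph_free (complete_graph (r - 1)) F ->
  exists a b j0, a = 2 * b + 1 /\
    forall j n, j0 <= j -> n <= 3 ^ (j * a) ->
      max_free_order F (complete_graph r) n <= 3 ^ (j * b).
Proof.
move=> r4 Ffree; have [F0|F0] := posnP #|F|.
  (* An [F] without vertices lies in every graph, so the value is 0, witnessed by the edgeless
     graph. *)
  exists 1, 0, 0; split=> // j n _ _; apply: leq_trans (_ : 0 <= _) => //.
  pose e : rel 'I_n := fun _ _ => false.
  have e_sym : symmetric e by [].
  have e_irr : irreflexive e by [].
  apply: (@max_free_order_le F r n 0 (SGraph e_sym e_irr)); first by rewrite card_ord.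
    move=> [phi _ phi_adj]; case: r r4 Ffree phi phi_adj => [//|[//|r]] _ _ phi phi_adj.
    by have := phi_adj ord0 (lift ord0 ord0) isT.
  move=> S _; have F_empty (x : F) : False by have := fintype0 x F0.
  by exists (fun x => False_rect _ (F_empty x)) => x; case: (F_empty x).
have [j0 hj0] := large_plane_graphs F0 erefl erefl r4 Ffree.
set L := 20 * #|F| + 5 in hj0; exists (2 * L - 5), (L - 3), j0; split.
  by rewrite /L; lia.
move=> j n /hj0[G [cG Gfree Gcont]] nj; rewrite [3 ^ (j * (L - 3))]expnM.
by apply: max_free_order_le Gfree Gcont; rewrite cG -expnM.
Qed.

End Extremal.

(* Asymptotics *)
From mathcomp Require Import all_classical all_reals all_analysis.
Import Order.TTheory GRing.Theory Num.Theory.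
Import numFieldNormedType.Exports.
Local Open Scope classical_set_scope.
Local Open Scope ring_scope.

Theorem theorem1p2 (R : realType) (r : nat) (r_ge4 : (4 <= r)%N)
    (F : sgraph) (F_free : graph_free (complete_graph (r - 1)) F) :
  exists2 eps : R, 0 < eps &
    (fun n : nat => (max_free_order F (complete_graph r) n)%:R : R)
      =O_\oo (fun n : nat => n%:R `^ (1 / 2 - eps)).
Proof.
have [a [b [j0 [ab bound]]]] := max_free_order_bound r_ge4 F_free.
have a0 : (0 < a)%N by rewrite ab addn1.
have aR : a%:R != 0 :> R by rewrite pnatr_eq0 -lt0n.
(* As [a = 2 * b + 1], this choice makes the exponent equal to [b / a]. *)
exists (1 / (2 * a%:R)); first by rewrite divr_gt0 // mulr_gt0 // ltr0n.
have -> : 1 / 2 - 1 / (2 * a%:R) = b%:R / a%:R :> R.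
  have -> : b%:R = (a%:R - 1) / 2 :> R by rewrite ab natrD natrM; field.
  by field.
(* The constant covers the small [n], where [j = j0], and the factor [3 ^ b] lost in rounding [n] up
   to a power of [3 ^ a]. *)
apply/eqO_exP; exists (3 ^ (j0.+1 * b))%:R; first by rewrite ltr0n expn_gt0.
near=> n.
have n0 : (0 < n)%N by near: n; exists 1%N.
rewrite ger0_norm ?ler0n // ger0_norm ?powR_ge0 //.
have exj : exists j, (j0 <= j)%N && (n <= 3 ^ (j * a))%N.
  exists (j0 + n)%N; rewrite leq_addr /=.
  apply: leq_trans (ltnW (ltn_expl n (isT : 1 < 3)%N)) _.
  by rewrite leq_pexp2l // mulnDl -[X in (X <= _)%N]muln1 (leq_trans _ (leq_addl _ _)) // leq_mul2l a0 orbT.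
(* For the least [j], either [j = j0], or [3 ^ ((j - 1) * a) < n] and [root] bounds
   [3 ^ ((j - 1) * b)]. *)
case: (ex_minnP exj) => j /andP[j0j nj] jmin.
apply: le_trans (_ : (3 ^ (j * b))%:R <= _); first by rewrite ler_nat bound.
have root c : (3 ^ (c * a) <= n)%N -> (3 ^ (c * b))%:R <= n%:R `^ (b%:R / a%:R) :> R.
  move=> cn; have -> : (3 ^ (c * b))%:R = (3 ^ (c * a))%:R `^ (b%:R / a%:R) :> R.
    rewrite !natrX -!powR_mulrn // -powRrM; congr (_ `^ _).
    by rewrite !natrM; field.
  by apply: ge0_ler_powR; rewrite ?divr_ge0 ?ler0n ?nnegrE ?ler_nat.
have [jj|jj] := leqP j j0.
  have -> : j = j0 by apply/eqP; rewrite eqn_leq jj.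
  apply: le_trans (_ : (3 ^ (j0.+1 * b))%:R * 1 <= _).
    by rewrite mulr1 ler_nat leq_pexp2l // leq_mul2r leqnSn orbT.
  by rewrite ler_wpM2l ?ler0n //; have := root 0%N n0; rewrite !mul0n expn0.
case: j j0j nj jmin jj => [//|j] _ nj jmin jj.
rewrite mulSn expnD natrM; apply: ler_pM; rewrite ?ler0n //.
  by rewrite ler_nat leq_pexp2l // mulSn leq_addr.
apply: root; rewrite leqNgt; apply/negP => /ltnW nj'.
by have := jmin j; rewrite -ltnS jj nj' ltnn => /(_ isT).
Unshelve. all: by end_near.
Qed.
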